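(* Let $(\phi_t)$ be a parabolic semigroup of zero hyperbolic step in $\mathbb{H}$ with Denjoy--Wolff point $\infty$. The following are equivalent: (a) $(\phi_t)$ is of extremal rate; (b) $\limsup_{t\to+\infty}\left(d_{\mathbb{H}}(i,\phi_t(z))-\frac14\log t\right)<+\infty$ for some (equivalently, all) $z\in\mathbb{H}$; (c) $\lim_{t\to+\infty}\left(d_{\mathbb{H}}(i,\phi_t(z))-\frac14\log t\right)$ exists in $\mathbb{R}$ for some (equivalently, all) $z\in\mathbb{H}$. Moreover, if these hold, then for all $z\in\mathbb{H}$, $$\lim_{t\to+\infty}\left(d_{\mathbb{H}}(i,\phi_t(z))-\frac14\log t\right)=\frac12\log\left(\lim_{t\to+\infty}\frac{|\phi_t(i)|}{\sqrt t}\right).$$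
   Context: $\mathbb{H}$ is the upper half-plane with hyperbolic distance $d_{\mathbb{H}}(z,w)=\frac12\log\frac{1+\rho}{1-\rho}$, $\rho=|z-w|/|z-\bar w|$. A semigroup in $\mathbb{H}$ is a family $(\phi_t)_{t\ge0}$ of holomorphic self-maps of $\mathbb{H}$ with $\phi_0=\mathrm{id}$, $\phi_{t+s}=\phi_t\circ\phi_s$, and $\phi_t\to\mathrm{id}$ pointwise as $t\to0^+$. Non-elliptic: no fixed points of $\phi_t$, $t>0$, in $\mathbb{H}$; orbits converge to a common boundary point (Denjoy--Wolff point). With Denjoy--Wolff point $\infty$, parabolic means $\angle\lim_{z\to\infty}\phi_t(z)/z=1$; zero hyperbolic step means $d_{\mathbb{H}}(\phi_{t+1}(z),\phi_t(z))\to0$ as $t\to+\infty$. Extremal rate: there is $L\in(0,+\infty)$ with $\lim_{t\to+\infty}|\phi_t(z)|/\sqrt t=L$ for all $z\in\mathbb{H}$. *)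

(* Defs.v *)
From Stdlib Require Import Reals.
From Coquelicot Require Export Coquelicot.
Open Scope R_scope.

Definition inH (z : C) : Prop := 0 < Im z.


Definition rhoH (z w : C) : R := Cmod (Cminus z w) / Cmod (Cminus z (Cconj w)).
Definition dH (z w : C) : R := / 2 * ln ((1 + rhoH z w) / (1 - rhoH z w)).

Definition holomorphic_on_H (f : C -> C) : Prop :=
  forall z, inH z -> @ex_derive C_AbsRing C_NormedModule f z.

Definition semigroupH (phi : R -> C -> C) : Prop :=
  (forall t, 0 <= t -> holomorphic_on_H (phi t)) /\
  (forall t z, 0 <= t -> inH z -> inH (phi t z)) /\
  (forall z, inH z -> phi 0 z = z) /\
  (forall t s z, 0 <= t -> 0 <= s -> inH z -> phi (t + s) z = phi t (phi s z)) /\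
  (forall z, inH z -> filterlim (fun t => phi t z) (at_right 0) (locally z)).

Definition non_ellipticH (phi : R -> C -> C) : Prop :=
  forall t z, 0 < t -> inH z -> phi t z <> z.

Definition DW_infty (phi : R -> C -> C) : Prop :=
  forall z, inH z -> is_lim (fun t => Cmod (phi t z)) p_infty p_infty.

Definition angular_lim_infty (g : C -> C) (l : C) : Prop :=
  forall M eps, 0 < M -> 0 < eps -> exists Rr, forall z,
    inH z -> Rabs (Re z) <= M * Im z -> Rr < Cmod z -> Cmod (Cminus (g z) l) < eps.

Definition parabolicH (phi : R -> C -> C) : Prop :=
  forall t, 0 < t -> angular_lim_infty (fun z => Cdiv (phi t z) z) (RtoC 1).

Definition zero_hyp_step (phi : R -> C -> C) : Prop :=
  forall z, inH z -> is_lim (fun t => dH (phi (t + 1) z) (phi t z)) p_infty 0.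

Definition extremal_rate (phi : R -> C -> C) : Prop :=
  exists L, 0 < L /\ forall z, inH z ->
    is_lim (fun t => Cmod (phi t z) / sqrt t) p_infty L.

Definition devH (phi : R -> C -> C) (z : C) (t : R) : R :=
  dH Ci (phi t z) - / 4 * ln t.

Definition limsup_finite_above (f : R -> R) : Prop :=
  exists M T, forall t, T < t -> f t <= M.

Definition has_real_lim (f : R -> R) : Prop :=
  exists l : R, is_lim f p_infty l.

(* Main.v *)
(** Fix a time step [h]. By Julia's lemma [F := phi h - id] maps the half-plane into its closure, so
    [Phi := - 1 / F] does too; let [b >= 0] be the infimum of [Im (Phi z) / Im z]. Then
    [Phi z = b z + p z] with [p z = o(z)] nontangentially (Julia-Wolff-Caratheodory).

    If [b > 0], then [(phi h z)^2 = z^2 - 2/b + o(1)] nontangentially, so orbits starting high on the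
    imaginary axis satisfy [(phi (n h) z)^2 ~ - 2 n / b]; by the Schwarz-Pick contraction the same
    holds for every orbit, and right continuity at [t = 0] passes from the lattice [h N] to all
    times: [phi t z ~ i l sqrt t] with [l] independent of [z]. This gives (a), (c) and the value
    of the limit.

    If [b = 0], no orbit is [O(sqrt t)]: either [r Im (F (i r))] is unbounded and Schwarz-Pick makes
    [Im (phi (n h) z)] grow at least linearly, or [F] stays close to a nonzero real constant and the
    orbit drifts linearly. Both (a) and (b) force an [O(sqrt t)] orbit.

    The Schwarz-Pick inequality is derived from scratch: Goursat's lemma on rectangles in logarithmic
    polar coordinates gives the mean value property, and a strictly subharmonic barrier gives a
    maximum principle on the left half-plane, onto which the punctured disc is lifted by [exp]. *)

Require Import Defs.
From Stdlib Require Import Reals Lra Psatz Lia Classical_Prop.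
From Coquelicot Require Import Coquelicot.
Open Scope R_scope.

(** * Goursat's lemma *)

(** Holomorphy is given as bare pointwise differentiability, with no continuous derivative: hence
    bisection instead of Green's formula. In Schwarz's lemma the quotient has a removable
    singularity at the base point; the lift by [exp] sends it to Re s = -oo, where a mere bound is
    enough. From then on the tool is the two-point inequality [pick], established for [phi h], for
    [F] and for [p]. It is kept free of denominators, so that it survives limits and values on the
    boundary, and each asymptotic claim becomes a comparison of the moving point with one well
    chosen point. Squares appear because F = -1/(b z + p) gives f^2 - z^2 = 2 z F + F^2, which tends
    to -2/b: in the variable z^2 the map is nearly a translation, and its errors telescope. The
    obstacle is that this holds only in Stolz angles, while an arbitrary orbit is not known to stay
    in one. One orbit is therefore trapped near the imaginary axis first, and the others remain at
    bounded hyperbolic distance from it. *)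

Lemma differentiable_continuous_x (P : R -> R -> R) x y px py :
  differentiable_pt_lim P x y px py -> continuous (fun u => P u y) x.
Proof.
  intros H.
  assert (H2 : continuity_2d_pt P x y).
  { apply differentiable_continuity_pt. exists px, py. exact H. }
  intros A HA. destruct HA as [e He].
  destruct (H2 e) as [d Hd]. exists d. intros u Hu. apply He.
  apply (Hd u y Hu). rewrite Rminus_diag, Rabs_R0. apply cond_pos.
Qed.

Lemma differentiable_continuous_y (P : R -> R -> R) x y px py :
  differentiable_pt_lim P x y px py -> continuous (fun v => P x v) y.
Proof.
  intros H.
  assert (H2 : continuity_2d_pt P x y).
  { apply differentiable_continuity_pt. exists px, py. exact H. }
  intros A HA. destruct HA as [e He].
  destruct (H2 e) as [d Hd]. exists d. intros u Hu. apply He.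
  apply (Hd x u). rewrite Rminus_diag, Rabs_R0. apply cond_pos. exact Hu.
Qed.

Lemma RInt_near_const (f : R -> R) (a b k e : R) :
  a <= b -> ex_RInt f a b ->
  (forall x, a <= x <= b -> Rabs (f x - k) <= e) ->
  Rabs (RInt f a b - k * (b - a)) <= e * (b - a).
Proof.
  intros ab Hf H.
  assert (H1 : RInt (fun _ => k - e) a b <= RInt f a b).
  { apply RInt_le; trivial. apply ex_RInt_const.
    intros x Hx. specialize (H x). assert (a <= x <= b) by lra.
    apply H in H0. apply Rabs_le_between in H0. lra. }
  assert (H2 : RInt f a b <= RInt (fun _ => k + e) a b).
  { apply RInt_le; trivial. apply ex_RInt_const.
    intros x Hx. specialize (H x). assert (a <= x <= b) by lra.
    apply H in H0. apply Rabs_le_between in H0. lra. }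
  rewrite RInt_const in H1, H2. unfold scal in *; simpl in *. unfold mult in *; simpl in *.
  apply Rabs_le_between. nra.
Qed.

(** The shared [py] encodes P_y = Q_x, that is, closedness of the form P dx + Q dy, without
    continuity of the partial derivatives. *)
Definition locally_closed_form (P Q : R -> R -> R) (a b c d : R) : Prop :=
  forall x y, a <= x <= b -> c <= y <= d -> exists px py qy,
    differentiable_pt_lim P x y px py /\ differentiable_pt_lim Q x y py qy.

(** The counterclockwise integral of P dx + Q dy along the rectangle. *)
Definition boundary_int (P Q : R -> R -> R) (a b c d : R) : R :=
  RInt (fun x => P x c) a b - RInt (fun x => P x d) a b +
  (RInt (fun y => Q b y) c d - RInt (fun y => Q a y) c d).

Lemma closed_form_ex_RInt_x P Q a b c d y a' b' :
  locally_closed_form P Q a b c d -> a <= a' <= b' -> b' <= b -> c <= y <= d ->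
  ex_RInt (fun x => P x y) a' b'.
Proof.
  intros H Ha Hb Hy. apply (ex_RInt_continuous (V := R_CompleteNormedModule)).
  intros z Hz. rewrite Rmin_left, Rmax_right in Hz by lra.
  destruct (H z y) as (px & py & qy & H1 & _); try lra.
  eapply differentiable_continuous_x; eassumption.
Qed.

Lemma closed_form_ex_RInt_y P Q a b c d x c' d' :
  locally_closed_form P Q a b c d -> c <= c' <= d' -> d' <= d -> a <= x <= b ->
  ex_RInt (fun y => Q x y) c' d'.
Proof.
  intros H Ha Hb Hy. apply (ex_RInt_continuous (V := R_CompleteNormedModule)).
  intros z Hz. rewrite Rmin_left, Rmax_right in Hz by lra.
  destruct (H x z) as (px & py & qy & _ & H1); try lra.
  eapply differentiable_continuous_y; eassumption.
Qed.

Lemma boundary_int_split P Q a b c d m n :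
  locally_closed_form P Q a b c d -> a <= m <= b -> c <= n <= d ->
  boundary_int P Q a b c d =
  boundary_int P Q a m c n + boundary_int P Q m b c n +
  (boundary_int P Q a m n d + boundary_int P Q m b n d).
Proof.
  intros H Hm Hn. unfold boundary_int.
  assert (E1 : forall y, c <= y <= d -> RInt (fun x => P x y) a b =
     RInt (fun x => P x y) a m + RInt (fun x => P x y) m b).
  { intros y Hy. symmetry. apply (RInt_Chasles (V := R_CompleteNormedModule));
    eapply closed_form_ex_RInt_x; try eassumption; lra. }
  assert (E2 : forall x, a <= x <= b -> RInt (fun y => Q x y) c d =
     RInt (fun y => Q x y) c n + RInt (fun y => Q x y) n d).
  { intros y Hy. symmetry. apply (RInt_Chasles (V := R_CompleteNormedModule));
    eapply closed_form_ex_RInt_y; try eassumption; lra. }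
  rewrite (E1 c), (E1 d), (E2 a), (E2 b) by lra. ring.
Qed.

Lemma closed_form_sub P Q a b c d a' b' c' d' :
  locally_closed_form P Q a b c d -> a <= a' -> b' <= b -> c <= c' -> d' <= d ->
  locally_closed_form P Q a' b' c' d'.
Proof. intros H ? ? ? ? x y Hx Hy. apply H; lra. Qed.

(** * Bisection of rectangles *)

Record rect := Rect { x_lo : R; x_hi : R; y_lo : R; y_hi : R }.

Definition rect_int P Q (r : rect) : R := boundary_int P Q (x_lo r) (x_hi r) (y_lo r) (y_hi r).

(** The fourth quarter is returned untested: when the other three fail, the triangle inequality
    forces it to carry at least a quarter of the integral. *)
Definition worst_quarter P Q (r : rect) : rect :=
  let m := (x_lo r + x_hi r) / 2 in
  let n := (y_lo r + y_hi r) / 2 in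
  let big q := Rle_dec (Rabs (rect_int P Q r) / 4) (Rabs (rect_int P Q q)) in
  let q1 := Rect (x_lo r) m (y_lo r) n in
  let q2 := Rect m (x_hi r) (y_lo r) n in
  let q3 := Rect (x_lo r) m n (y_hi r) in
  let q4 := Rect m (x_hi r) n (y_hi r) in
  if big q1 then q1 else if big q2 then q2 else if big q3 then q3 else q4.

Definition rect_in (q r : rect) : Prop :=
  x_lo r <= x_lo q <= x_hi q /\ x_hi q <= x_hi r /\ y_lo r <= y_lo q <= y_hi q /\ y_hi q <= y_hi r.

Lemma worst_quarter_spec P Q r :
  locally_closed_form P Q (x_lo r) (x_hi r) (y_lo r) (y_hi r) ->
  x_lo r <= x_hi r -> y_lo r <= y_hi r ->
  let q := worst_quarter P Q r in
  rect_in q r /\ x_hi q - x_lo q = (x_hi r - x_lo r) / 2 /\ y_hi q - y_lo q = (y_hi r - y_lo r) / 2 /\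
  Rabs (rect_int P Q r) / 4 <= Rabs (rect_int P Q q).
Proof.
  intros H Hx Hy. unfold worst_quarter.
  set (m := (x_lo r + x_hi r) / 2). set (n := (y_lo r + y_hi r) / 2).
  assert (Hm : x_lo r <= m <= x_hi r) by (unfold m; lra).
  assert (Hn : y_lo r <= n <= y_hi r) by (unfold n; lra).
  pose proof (boundary_int_split P Q _ _ _ _ m n H Hm Hn) as E.
  cbv zeta.
  repeat destruct Rle_dec; unfold rect_in; simpl; repeat split; try lra; try (unfold m, n; lra); trivial.
  unfold rect_int in *; simpl in *. rewrite E in *.
  assert (T : forall u v w z, Rabs (u + v + (w + z)) <= Rabs u + Rabs v + (Rabs w + Rabs z)).
  { intros. eapply Rle_trans. apply Rabs_triang. apply Rplus_le_compat; apply Rabs_triang. }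
  match goal with |- Rabs (?u + ?v + (?w + ?z)) / 4 <= _ => pose proof (T u v w z) end.
  lra.
Qed.

Lemma nested_intervals (u v : nat -> R) :
  (forall n, u n <= u (S n)) -> (forall n, v (S n) <= v n) -> (forall n, u n <= v n) ->
  exists l, forall n, u n <= l <= v n.
Proof.
  intros Hu Hv Huv.
  assert (Mu : forall n m, (n <= m)%nat -> u n <= u m).
  { intros n m Hnm. induction Hnm. lra. specialize (Hu m). lra. }
  assert (Mv : forall n m, (n <= m)%nat -> v m <= v n).
  { intros n m Hnm. induction Hnm. lra. specialize (Hv m). lra. }
  destruct (completeness (fun x => exists n, x = u n)) as [l [Hl1 Hl2]].
  - exists (v 0%nat). intros x [n ->]. apply Rle_trans with (v n); trivial. apply Mv; lia.
  - exists (u 0%nat), 0%nat. reflexivity.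
  - exists l. intros n. split.
    + apply Hl1. exists n; reflexivity.
    + apply Hl2. intros x [k ->].
      apply Rle_trans with (u (max k n)). apply Mu; lia.
      apply Rle_trans with (v (max k n)); trivial. apply Mv; lia.
Qed.

(** To first order, opposite horizontal sides contribute - py (d - c) (b - a) and opposite vertical
    sides py (b - a) (d - c), which cancel because the form is closed. Each difference of two
    opposite sides has error at most twice e/2 times the half perimeter. *)
Lemma goursat_small P Q x y px py qy e :
  0 < e -> differentiable_pt_lim P x y px py -> differentiable_pt_lim Q x y py qy ->
  exists delta, 0 < delta /\ forall a b c d,
    a <= x <= b -> c <= y <= d -> b - a < delta -> d - c < delta ->
    locally_closed_form P Q a b c d ->
    Rabs (boundary_int P Q a b c d) <= e * Rsqr ((b - a) + (d - c)).
Proof.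
  intros He HP HQ.
  set (e2 := mkposreal (e / 2) ltac:(lra)).
  destruct (HP e2) as [d1 H1]. destruct (HQ e2) as [d2 H2].
  exists (Rmin d1 d2). split. { apply Rmin_pos; apply cond_pos. }
  intros a b c d Hx Hy Hab Hcd Hcl.
  assert (Hd1 := Rmin_l d1 d2). assert (Hd2 := Rmin_r d1 d2).
  assert (BX : forall u, a <= u <= b -> Rabs (u - x) <= b - a).
  { intros u Hu. apply Rabs_le_between. lra. }
  assert (BY : forall u, c <= u <= d -> Rabs (u - y) <= d - c).
  { intros u Hu. apply Rabs_le_between. lra. }
  set (s := (b - a) + (d - c)).
  assert (MX : forall u v, a <= u <= b -> c <= v <= d -> Rmax (Rabs (u - x)) (Rabs (v - y)) <= s).
  { intros u v Hu Hv. apply BX in Hu. apply BY in Hv. unfold s. apply Rmax_lub; lra. }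
  assert (EP : forall u v, a <= u <= b -> c <= v <= d ->
     Rabs (P u v - P x y - (px * (u - x) + py * (v - y))) <= e / 2 * s).
  { intros u v Hu Hv. eapply Rle_trans. apply H1.
    apply BX in Hu; lra. apply BY in Hv; lra.
    simpl. apply Rmult_le_compat_l. lra. apply MX; trivial. }
  assert (EQ : forall u v, a <= u <= b -> c <= v <= d ->
     Rabs (Q u v - Q x y - (py * (u - x) + qy * (v - y))) <= e / 2 * s).
  { intros u v Hu Hv. eapply Rle_trans. apply H2.
    apply BX in Hu; lra. apply BY in Hv; lra.
    simpl. apply Rmult_le_compat_l. lra. apply MX; trivial. }
  unfold boundary_int.
  rewrite <- (RInt_minus (V := R_CompleteNormedModule)) by
    (eapply closed_form_ex_RInt_x; try eassumption; lra).
  rewrite <- (RInt_minus (V := R_CompleteNormedModule) (fun y => Q b y)) by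
    (eapply closed_form_ex_RInt_y; try eassumption; lra).
  unfold minus, plus, opp; simpl.
  assert (I1 : Rabs (RInt (fun u => P u c + - P u d) a b - (- py * (d - c)) * (b - a)) <= e * s * (b - a)).
  { apply RInt_near_const. lra.
    apply (ex_RInt_minus (V := R_NormedModule)); eapply closed_form_ex_RInt_x; try eassumption; lra.
    intros u Hu.
    assert (A1 := EP u c Hu ltac:(lra)). assert (A2 := EP u d Hu ltac:(lra)).
    apply Rabs_le_between in A1. apply Rabs_le_between in A2. apply Rabs_le_between. lra. }
  assert (I2 : Rabs (RInt (fun v => Q b v + - Q a v) c d - (py * (b - a)) * (d - c)) <= e * s * (d - c)).
  { apply RInt_near_const. lra.
    apply (ex_RInt_minus (V := R_NormedModule)); eapply closed_form_ex_RInt_y; try eassumption; lra.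
    intros u Hu.
    assert (A1 := EQ b u ltac:(lra) Hu). assert (A2 := EQ a u ltac:(lra) Hu).
    apply Rabs_le_between in A1. apply Rabs_le_between in A2. apply Rabs_le_between. lra. }
  apply Rabs_le_between in I1. apply Rabs_le_between in I2. apply Rabs_le_between.
  replace (e * s²) with (e * s * (b - a) + e * s * (d - c)) by (unfold s, Rsqr; ring).
  lra.
Qed.

Lemma goursat_rectangle P Q a b c d :
  a <= b -> c <= d -> locally_closed_form P Q a b c d -> boundary_int P Q a b c d = 0.
Proof.
  intros Hab Hcd H.
  set (r := fun n => Nat.iter n (worst_quarter P Q) (Rect a b c d)).
  assert (Hr : forall n, rect_in (r n) (Rect a b c d) /\
     x_hi (r n) - x_lo (r n) = (b - a) * (/ 2) ^ n /\ y_hi (r n) - y_lo (r n) = (d - c) * (/ 2) ^ n /\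
     Rabs (boundary_int P Q a b c d) * (/ 4) ^ n <= Rabs (rect_int P Q (r n)) /\
     rect_in (r (S n)) (r n)).
  { assert (Hs : forall n, rect_in (r n) (Rect a b c d) -> 
        let q := worst_quarter P Q (r n) in
  rect_in q (r n) /\ x_hi q - x_lo q = (x_hi (r n) - x_lo (r n)) / 2 /\ y_hi q - y_lo q = (y_hi (r n) - y_lo (r n)) / 2 /\
  Rabs (rect_int P Q (r n)) / 4 <= Rabs (rect_int P Q q)).
    { intros n (A1 & A2 & A3 & A4). simpl in *. apply worst_quarter_spec; try lra.
      eapply closed_form_sub; try eassumption; lra. }
    induction n.
    - assert (I0 : rect_in (r 0%nat) (Rect a b c d)) by (unfold rect_in; simpl; lra).
      destruct (Hs 0%nat I0) as (A1 & _). simpl.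
      repeat split; try (apply I0); try (simpl; lra); try apply A1.
      unfold rect_int; simpl; lra.
    - destruct IHn as (B1 & B2 & B3 & B4 & B5).
      assert (I0 : rect_in (r (S n)) (Rect a b c d)) by (unfold rect_in in *; simpl in *; lra).
      destruct (Hs n B1) as (A1 & A2 & A3 & A4).
      destruct (Hs (S n) I0) as (A1' & _).
      change (worst_quarter P Q (r n)) with (r (S n)) in *.
      change (worst_quarter P Q (r (S n))) with (r (S (S n))) in *.
      repeat split; try apply I0; try apply A1'; simpl pow; lra. }
  destruct (nested_intervals (fun n => x_lo (r n)) (fun n => x_hi (r n))) as [x Hx];
    try (intros n; destruct (Hr n) as (A & _ & _ & _ & B); unfold rect_in in *; simpl in *; lra).
  destruct (nested_intervals (fun n => y_lo (r n)) (fun n => y_hi (r n))) as [y Hy];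
    try (intros n; destruct (Hr n) as (A & _ & _ & _ & B); unfold rect_in in *; simpl in *; lra).
  destruct (H x y (Hx 0%nat) (Hy 0%nat)) as (px & py & qy & HP & HQ).
  set (s := (b - a) + (d - c)).
  apply Rabs_eq_0. apply Rle_antisym; [|apply Rabs_pos].
  apply Rnot_lt_le. intros Hpos.
  set (I := Rabs (boundary_int P Q a b c d)) in *.
  assert (Hs : 0 < s * s + 1) by nra.
  (* Integral and squared perimeter both scale by 4^-n, so the contradiction only needs e s^2 < I;
     the summand 1 covers a rectangle reduced to a point. *)
  set (e := I / (2 * (s * s + 1))).
  assert (He : 0 < e) by (apply Rdiv_lt_0_compat; lra).
  destruct (goursat_small P Q x y px py qy e He HP HQ) as (delta & Hdelta & Hd).
  assert (Hsd : 0 < delta / (s + 1)) by (apply Rdiv_lt_0_compat; unfold s; lra).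
  destruct (pow_lt_1_zero (/ 2) ltac:(rewrite Rabs_pos_eq; lra) _ Hsd) as [N HN].
  specialize (HN N (Nat.le_refl N)).
  assert (Hp : 0 < (/ 2) ^ N) by (apply pow_lt; lra).
  rewrite Rabs_pos_eq in HN by lra.
  assert (HN2 : (/ 2) ^ N * (s + 1) < delta).
  { apply Rmult_lt_compat_r with (r := s + 1) in HN; [|unfold s; lra].
    unfold Rdiv in HN. rewrite Rmult_assoc, Rinv_l in HN; unfold s in *; lra. }
  destruct (Hr N) as (B1 & B2 & B3 & B4 & _).
  assert (Hw : x_hi (r N) - x_lo (r N) < delta) by (rewrite B2; unfold s in *; nra).
  assert (Hh : y_hi (r N) - y_lo (r N) < delta) by (rewrite B3; unfold s in *; nra).
  assert (Hf := Hd _ _ _ _ (Hx N) (Hy N) Hw Hh).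
  assert (Hc : locally_closed_form P Q (x_lo (r N)) (x_hi (r N)) (y_lo (r N)) (y_hi (r N))).
  { unfold rect_in in B1; simpl in B1. eapply closed_form_sub; try eassumption; lra. }
  specialize (Hf Hc). change (Rabs (rect_int P Q (r N)) <= e * (x_hi (r N) - x_lo (r N) + (y_hi (r N) - y_lo (r N)))²) in Hf.
  rewrite B2, B3 in Hf.
  replace (/ 4) with (/ 2 * / 2) in B4 by lra. rewrite Rpow_mult_distr in B4.
  assert (Hfin : I * ((/ 2) ^ N * (/ 2) ^ N) <= (e * (s * s)) * ((/ 2) ^ N * (/ 2) ^ N)).
  { unfold Rsqr, s in *. nra. }
  apply Rmult_le_reg_r in Hfin; [|nra].
  assert (E2 : e * (2 * (s * s + 1)) = I) by (unfold e; field; lra).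
  nra.
Qed.

(** * Complex differentiation *)

Notation is_cderive f z l := (is_derive (K := C_AbsRing) (V := AbsRing_NormedModule C_AbsRing) f z l).
Notation ex_cderive f z := (ex_derive (K := C_AbsRing) (V := AbsRing_NormedModule C_AbsRing) f z).

Lemma is_cderive_iff (f : C -> C) (z l : C) :
  is_cderive f z l <->
  forall eps, 0 < eps -> exists delta, 0 < delta /\
    forall w, Cmod (w - z)%C < delta -> Cmod (f w - f z - l * (w - z))%C <= eps * Cmod (w - z)%C.
Proof.
  split.
  - intros [_ H] eps Heps.
    destruct (H z (fun P HP => HP) (mkposreal eps Heps)) as [d Hd].
    exists d. split. apply cond_pos. intros w Hw. specialize (Hd w Hw).
    simpl in Hd. unfold norm, minus, plus, opp, scal in Hd. simpl in Hd.
    unfold mult in Hd; simpl in Hd.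
    replace (f w - f z - l * (w - z))%C with (f w + - f z + - ((w + - z) * l))%C by ring.
    exact Hd.
  - intros H. split. apply is_linear_scal_l.
    intros x Hx. replace x with z.
    2:{ apply (is_filter_lim_locally_unique (K := C_AbsRing) (V := AbsRing_NormedModule C_AbsRing)). exact Hx. }
    intros eps. destruct (H eps (cond_pos eps)) as (d & Hd & Hw).
    exists (mkposreal d Hd). intros w Bw. specialize (Hw w Bw).
    simpl. unfold norm, minus, plus, opp, scal. simpl.
    unfold mult; simpl.
    replace (f w + - f z + - ((w + - z) * l))%C with (f w - f z - l * (w - z))%C by ring.
    exact Hw.
Qed.

(** [C_NormedModule] and the normed module of the absolute ring are packaged differently, but the
    derivative unfolds to the same norm estimates, so its components can be repacked. *)
Lemma holomorphic_ex_cderive (f : C -> C) z :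
  @ex_derive C_AbsRing C_NormedModule f z -> ex_cderive f z.
Proof.
  intros [l [[H1 H2 H3] H4]]. exists l. split; [split|]; [exact H1|exact H2|exact H3|exact H4].
Qed.

Lemma ex_cderive_continuous (f : C -> C) z : ex_cderive f z ->
  forall eps, 0 < eps -> exists delta, 0 < delta /\
    forall w, Cmod (w - z)%C < delta -> Cmod (f w - f z)%C < eps.
Proof.
  intros [l Hl]. rewrite is_cderive_iff in Hl. intros eps Heps.
  destruct (Hl 1 Rlt_0_1) as (d & Hd & H).
  assert (Hl0 := Cmod_ge_0 l).
  exists (Rmin d (eps / (Cmod l + 2))). split.
  { apply Rmin_pos; trivial. apply Rdiv_lt_0_compat; lra. }
  intros w Hw. apply Rmin_Rgt in Hw as [Hw1 Hw2].
  specialize (H w Hw1).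
  replace (f w - f z)%C with ((f w - f z - l * (w - z)) + l * (w - z))%C by ring.
  eapply Rle_lt_trans. apply Cmod_triangle. rewrite Cmod_mult.
  apply (Rmult_gt_compat_l (Cmod l + 2)) in Hw2; [|lra].
  unfold Rdiv in Hw2. rewrite (Rmult_comm eps), <- Rmult_assoc, Rinv_r in Hw2 by lra.
  assert (H0 := Cmod_ge_0 (w - z)%C). nra.
Qed.

Lemma ex_cderive_const (c z : C) : ex_cderive (fun _ => c) z.
Proof. apply ex_derive_const. Qed.

Lemma ex_cderive_id (z : C) : ex_cderive (fun w => w) z.
Proof. apply (ex_derive_id (K := C_AbsRing)). Qed.

Lemma ex_cderive_plus (f g : C -> C) z :
  ex_cderive f z -> ex_cderive g z -> ex_cderive (fun w => f w + g w)%C z.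
Proof. apply (ex_derive_plus (K := C_AbsRing) (V := AbsRing_NormedModule C_AbsRing)). Qed.

Lemma ex_cderive_minus (f g : C -> C) z :
  ex_cderive f z -> ex_cderive g z -> ex_cderive (fun w => f w - g w)%C z.
Proof. apply (ex_derive_minus (K := C_AbsRing) (V := AbsRing_NormedModule C_AbsRing)). Qed.

Lemma ex_cderive_mult (f g : C -> C) z :
  ex_cderive f z -> ex_cderive g z -> ex_cderive (fun w => f w * g w)%C z.
Proof.
  intros [l Hl] [m Hm].
  pose proof (is_derive_mult (K := C_AbsRing) f g z l m Hl Hm Cmult_comm) as H.
  eexists. exact H.
Qed.

Lemma ex_cderive_comp (f g : C -> C) z :
  ex_cderive f (g z) -> ex_cderive g z -> ex_cderive (fun w => f (g w)) z.
Proof. apply (ex_derive_comp (K := C_AbsRing) (V := AbsRing_NormedModule C_AbsRing)). Qed.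

Lemma Cinv_derive (z : C) : z <> 0 -> ex_cderive Cinv z.
Proof.
  intros Hz. exists (- / (z * z))%C. apply is_cderive_iff. intros eps Heps.
  assert (Hm : 0 < Cmod z) by (apply Cmod_gt_0; trivial).
  exists (Rmin (Cmod z / 2) (eps * Cmod z ^ 3 / 2)). split.
  { apply Rmin_pos. lra. apply Rdiv_lt_0_compat; [|lra]. apply Rmult_lt_0_compat; trivial. apply pow_lt; trivial. }
  intros w Hw. apply Rmin_Rgt in Hw as [Hw1 Hw2].
  assert (Hwm : Cmod z / 2 < Cmod w).
  { assert (T := Cmod_triangle w (- (w - z))%C). rewrite Cmod_opp in T.
    replace (w + - (w - z))%C with z in T by ring. lra. }
  assert (Hw0 : w <> 0) by (apply Cmod_gt_0; lra).
  replace (/ w - / z - - / (z * z) * (w - z))%C with ((w - z) * (w - z) * / (z * z * w))%C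
    by (field; split; trivial).
  rewrite !Cmod_mult, Cmod_inv, !Cmod_mult by (repeat apply Cmult_neq_0; trivial).
  assert (H0 := Cmod_ge_0 (w - z)%C).
  assert (Hp : 0 < Cmod z * Cmod z * Cmod w) by (repeat apply Rmult_lt_0_compat; lra).
  apply (Rmult_le_reg_r (Cmod z * Cmod z * Cmod w)); trivial.
  rewrite Rmult_assoc, Rinv_l, Rmult_1_r by lra.
  assert (Cmod (w - z) <= eps * (Cmod z * Cmod z * Cmod w)).
  { apply Rle_trans with (eps * Cmod z ^ 3 / 2); [lra|].
    replace (eps * Cmod z ^ 3 / 2) with (eps * (Cmod z * Cmod z * (Cmod z / 2))) by field.
    apply Rmult_le_compat_l; [lra|]. apply Rmult_le_compat_l; nra. }
  nra.
Qed.

Lemma ex_cderive_inv (f : C -> C) z :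
  f z <> 0 -> ex_cderive f z -> ex_cderive (fun w => / f w)%C z.
Proof. intros H Hf. apply (ex_cderive_comp Cinv f); trivial. apply Cinv_derive; trivial. Qed.

Lemma ex_cderive_div (f g : C -> C) z :
  g z <> 0 -> ex_cderive f z -> ex_cderive g z -> ex_cderive (fun w => f w / g w)%C z.
Proof. intros H Hf Hg. apply ex_cderive_mult; trivial. apply ex_cderive_inv; trivial. Qed.

(** * The complex exponential *)

Definition Cexp (z : C) : C := (exp (Re z) * cos (Im z), exp (Re z) * sin (Im z)).

Lemma Cexp_plus (z w : C) : Cexp (z + w)%C = (Cexp z * Cexp w)%C.
Proof.
  unfold Cexp. rewrite re_plus, im_plus, exp_plus, cos_plus, sin_plus.
  apply injective_projections; simpl; ring.
Qed.

Lemma Cmod_Cexp (z : C) : Cmod (Cexp z) = exp (Re z).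
Proof.
  assert (H := exp_pos (Re z)).
  apply Rsqr_inj; [apply Cmod_ge_0|lra|]. rewrite !Rsqr_pow2, Cmod2_alt. unfold Cexp; simpl.
  assert (T := sin2_cos2 (Im z)). unfold Rsqr in T.
  transitivity (exp (Re z) * exp (Re z) * (sin (Im z) * sin (Im z) + cos (Im z) * cos (Im z))).
  ring. rewrite T; ring.
Qed.

Lemma Cexp_nz (z : C) : Cexp z <> 0.
Proof. apply Cmod_gt_0. rewrite Cmod_Cexp. apply exp_pos. Qed.

(** A logarithm of a single point, with no choice of branch; it lifts one point of the punctured
    disc to the left half-plane. *)
Lemma Cexp_polar (q : C) : q <> 0 -> exists z, Cexp z = q /\ Re z = ln (Cmod q).
Proof.
  intros Hq. assert (Hm : 0 < Cmod q) by (apply Cmod_gt_0; trivial).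
  set (a := Re q / Cmod q). set (b := Im q / Cmod q).
  assert (Hab : a * a + b * b = 1).
  { assert (T := Cmod2_alt q). unfold a, b.
    replace (Re q / Cmod q * (Re q / Cmod q) + Im q / Cmod q * (Im q / Cmod q))
      with ((Re q ^ 2 + Im q ^ 2) / (Cmod q ^ 2)) by (field; lra).
    rewrite <- T. field. lra. }
  assert (Ha : -1 <= a <= 1) by nra.
  assert (Hs : sin (acos a) = Rabs b).
  { rewrite sin_acos by trivial. rewrite <- (sqrt_Rsqr_abs b). f_equal. unfold Rsqr. lra. }
  assert (H : exists th, cos th = a /\ sin th = b).
  { destruct (Rle_dec 0 b).
    - exists (acos a). rewrite cos_acos, Hs, Rabs_pos_eq by trivial. auto.
    - exists (- acos a). rewrite cos_neg, sin_neg, cos_acos, Hs, Rabs_left by lra. split; lra. }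
  destruct H as (th & Hc & Hsn).
  exists (ln (Cmod q), th). split; [|reflexivity].
  unfold Cexp; simpl. rewrite exp_ln, Hc, Hsn by trivial.
  apply injective_projections; unfold a, b; simpl; [change (fst q) with (Re q)|change (snd q) with (Im q)]; field; lra.
Qed.

Lemma is_derive_small_o (f : R -> R) l : is_derive f 0 l ->
  forall eps, 0 < eps -> exists delta, 0 < delta /\ forall h, Rabs h < delta ->
    Rabs (f h - f 0 - l * h) <= eps * Rabs h.
Proof.
  intros H eps He. apply is_derive_Reals in H.
  destruct (H eps He) as [d Hd]. exists d. split; [apply cond_pos|].
  intros h Hh. destruct (Req_dec h 0) as [->|Hn].
  - rewrite Rmult_0_r, Rabs_R0, !Rminus_0_r, Rminus_diag, Rabs_R0. lra.
  - specialize (Hd h Hn Hh). rewrite Rplus_0_l in Hd.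
    replace (f h - f 0 - l * h) with (((f h - f 0) / h - l) * h) by (field; trivial).
    rewrite Rabs_mult. apply Rmult_le_compat_r. apply Rabs_pos. lra.
Qed.

Lemma Cexp_derive_0 eps : 0 < eps -> exists delta, 0 < delta /\ forall h, Cmod h < delta ->
  Cmod (Cexp h - 1 - h)%C <= eps * Cmod h.
Proof.
  (* Each coordinate of the error will be at most 4 e |h|, hence the modulus at most 8 e |h|. The
     cap at 1 keeps |exp x - 1| below 2 |h|, and [e] also serves as a radius, to make the product
     (exp x - 1) y small. *)
  intros Heps. set (e := Rmin eps 1 / 16).
  assert (He : 0 < e) by (apply Rdiv_lt_0_compat; [apply Rmin_pos|]; lra).
  assert (E1 : 16 * e <= eps) by (unfold e; assert (T := Rmin_l eps 1); lra).
  assert (E2 : 16 * e <= 1) by (unfold e; assert (T := Rmin_r eps 1); lra).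
  destruct (is_derive_small_o exp 1) with (eps := e) as (d1 & Hd1 & H1); trivial.
  { pose proof (is_derive_exp 0) as D. rewrite exp_0 in D. exact D. }
  destruct (is_derive_small_o cos 0) with (eps := e) as (d2 & Hd2 & H2); trivial.
  { pose proof (is_derive_cos 0) as D. rewrite sin_0, Ropp_0 in D. exact D. }
  destruct (is_derive_small_o sin 1) with (eps := e) as (d3 & Hd3 & H3); trivial.
  { pose proof (is_derive_sin 0) as D. rewrite cos_0 in D. exact D. }
  exists (Rmin (Rmin d1 e) (Rmin d2 d3)). split.
  { repeat apply Rmin_pos; trivial. }
  intros h Hh.
  apply Rmin_Rgt in Hh as [Hh Hh2]. apply Rmin_Rgt in Hh2 as [Hh2 Hh3].
  apply Rmin_Rgt in Hh as [Hh1 Hh].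
  destruct h as [x y].
  assert (Mx : Rabs x <= Cmod (x, y)) by apply (re_le_Cmod (x, y)).
  assert (My : Rabs y <= Cmod (x, y)).
  { apply Rle_trans with (Rmax (Rabs x) (Rabs y)). apply Rmax_r. apply (Rmax_Cmod (x, y)). }
  set (r := Cmod (x, y)) in *. assert (Hr : 0 <= r) by (apply Cmod_ge_0).
  specialize (H1 x ltac:(lra)). specialize (H2 y ltac:(lra)). specialize (H3 y ltac:(lra)).
  rewrite exp_0 in H1. rewrite cos_0 in H2. rewrite sin_0 in H3.
  assert (Px := Rabs_pos x). assert (Py := Rabs_pos y).
  assert (A : Rabs (exp x - 1) <= 2 * r).
  { replace (exp x - 1) with ((exp x - 1 - 1 * x) + x) by ring.
    eapply Rle_trans. apply Rabs_triang. nra. }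
  assert (He2 : exp x <= 2) by (apply Rabs_le_between in A; lra).
  assert (He0 := exp_pos x).
  assert (E : (Cexp (x, y) - 1 - (x, y))%C =
    ((exp x - 1 - 1 * x) + exp x * (cos y - 1 - 0 * y),
     exp x * (sin y - 0 - 1 * y) + (exp x - 1) * y)).
  { apply injective_projections; unfold Cexp; simpl; ring. }
  rewrite E.
  assert (B1 : Rabs ((exp x - 1 - 1 * x) + exp x * (cos y - 1 - 0 * y)) <= 4 * e * r).
  { eapply Rle_trans. apply Rabs_triang. rewrite Rabs_mult, (Rabs_pos_eq (exp x)) by lra.
    assert (T := Rabs_pos (cos y - 1 - 0 * y)). nra. }
  assert (B2 : Rabs (exp x * (sin y - 0 - 1 * y) + (exp x - 1) * y) <= 4 * e * r).
  { eapply Rle_trans. apply Rabs_triang. rewrite !Rabs_mult, (Rabs_pos_eq (exp x)) by lra.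
    assert (T := Rabs_pos (sin y - 0 - 1 * y)).
    assert (T2 := Rabs_pos (exp x - 1)).
    assert (exp x * Rabs (sin y - 0 - 1 * y) <= 2 * (e * r)) by nra.
    assert (Rabs (exp x - 1) * Rabs y <= (2 * r) * e) by (apply Rmult_le_compat; lra).
    lra. }
  eapply Rle_trans. apply Cmod_2Rmax.
  assert (S2 : sqrt 2 <= 2). { rewrite <- (sqrt_square 2) at 2 by lra. apply sqrt_le_1_alt. lra. }
  assert (S0 : 0 <= sqrt 2) by apply sqrt_pos.
  apply Rle_trans with (2 * (4 * e * r)); [|nra].
  apply Rmult_le_compat; trivial. eapply Rle_trans. apply Rabs_pos. apply Rmax_l.
  apply Rmax_lub; trivial.
Qed.

Lemma ex_cderive_Cexp (z : C) : ex_cderive Cexp z.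
Proof.
  exists (Cexp z). apply is_cderive_iff.
  intros eps He. assert (P := exp_pos (Re z)).
  destruct (Cexp_derive_0 (eps / exp (Re z))) as (d & Hd & H). apply Rdiv_lt_0_compat; lra.
  exists d. split; trivial. intros w Hw. specialize (H _ Hw).
  replace (Cexp w) with (Cexp z * Cexp (w - z))%C by (rewrite <- Cexp_plus; f_equal; ring).
  replace (Cexp z * Cexp (w - z) - Cexp z - Cexp z * (w - z))%C with (Cexp z * (Cexp (w - z) - 1 - (w - z)))%C by ring.
  rewrite Cmod_mult, Cmod_Cexp.
  apply Rmult_le_compat_l with (r := exp (Re z)) in H; [|lra].
  replace (exp (Re z) * (eps / exp (Re z) * Cmod (w - z))) with (eps * Cmod (w - z)) in H by (field; lra).
  exact H.
Qed.

(** * Mean value property and maximum principle *)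

Lemma Rabs_im_le_Cmod (z : C) : Rabs (Im z) <= Cmod z.
Proof. eapply Rle_trans; [apply Rmax_r|apply Rmax_Cmod]. Qed.

Lemma cauchy_riemann (g : C -> C) x y : ex_cderive g (x, y) -> exists a b,
  differentiable_pt_lim (fun u v => Re (g (u, v))) x y a (- b) /\
  differentiable_pt_lim (fun u v => Im (g (u, v))) x y b a.
Proof.
  intros [l Hl]. rewrite is_cderive_iff in Hl. exists (Re l), (Im l).
  assert (K : forall eps : posreal, locally_2d (fun u v =>
     Cmod (g (u, v) - g (x, y) - l * ((u, v) - (x, y)))%C <= eps * Rmax (Rabs (u - x)) (Rabs (v - y))) x y).
  { intros eps.
    assert (S2 : sqrt 2 <= 2). { rewrite <- (sqrt_square 2) at 2 by lra. apply sqrt_le_1_alt. lra. }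
    assert (B : forall u v, Cmod ((u, v) - (x, y))%C <= 2 * Rmax (Rabs (u - x)) (Rabs (v - y))).
    { intros u v. eapply Rle_trans. apply Cmod_2Rmax. apply Rmult_le_compat_r; trivial.
      eapply Rle_trans; [|apply Rmax_l]. apply Rabs_pos. }
    destruct (Hl (eps / 2)) as (d & Hd & H). apply Rdiv_lt_0_compat; [apply cond_pos|lra].
    assert (Hd2 : 0 < d / 2) by lra.
    exists (mkposreal _ Hd2). simpl. intros u v Hu Hv.
    specialize (H (u, v)). specialize (B u v).
    assert (Hm : Rmax (Rabs (u - x)) (Rabs (v - y)) < d / 2) by (apply Rmax_lub_lt; trivial).
    eapply Rle_trans. apply H. lra.
    assert (He := cond_pos eps). nra. }
  split; intros eps.
  - destruct (K eps) as [d Hd]. exists d. intros u v Hu Hv.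
    eapply Rle_trans; [|apply (Hd u v Hu Hv)].
    eapply Rle_trans; [|apply re_le_Cmod]. right. f_equal. unfold Re, Im; simpl. ring.
  - destruct (K eps) as [d Hd]. exists d. intros u v Hu Hv.
    eapply Rle_trans; [|apply (Hd u v Hu Hv)].
    eapply Rle_trans; [|apply Rabs_im_le_Cmod]. right. f_equal. unfold Re, Im; simpl. ring.
Qed.

(* Goursat in logarithmic polar coordinates: the circular mean is independent of the radius. *)
Lemma mean_value (g : C -> C) (z : C) (r : R) : 0 < r ->
  (forall w, Cmod (w - z)%C <= r -> ex_cderive g w) ->
  is_RInt (fun th => Re (g (z + Cexp (ln r, th))%C)) 0 (2 * PI) (2 * PI * Re (g z)).
Proof.
  intros Hr Hg.
  set (G := fun w => g (z + Cexp w)%C).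
  assert (HP := PI_RGT_0).
  assert (HG : forall x y, x <= ln r -> ex_cderive G (x, y)).
  { intros x y Hx. apply (ex_cderive_comp g).
    - apply Hg. replace (z + Cexp (x, y) - z)%C with (Cexp (x, y)) by ring. rewrite Cmod_Cexp. simpl.
      rewrite <- (exp_ln r) by trivial. destruct Hx as [Hx| ->]; [left; apply exp_increasing; trivial|lra].
    - apply ex_cderive_plus. apply ex_cderive_const. apply ex_cderive_Cexp. }
  (* P dx + Q dy is the imaginary part of G(w) dw. The two horizontal sides cancel by 2
     pi-periodicity of [Cexp], so the integrals of Re G over the two vertical sides agree. *)
  set (P := fun x y => Im (G (x, y))). set (Q := fun x y => Re (G (x, y))).
  assert (HF : forall s, locally_closed_form P Q s (ln r) 0 (2 * PI)).
  { intros s x y Hx Hy. destruct (cauchy_riemann G x y) as (a & b & H1 & H2). apply HG; lra.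
    exists b, a, (- b). auto. }
  assert (EX : forall s, s <= ln r -> ex_RInt (fun th => Q s th) 0 (2 * PI)).
  { intros s Hs. eapply (closed_form_ex_RInt_y P Q s (ln r) 0 (2 * PI)); try apply HF; lra. }
  change (is_RInt (fun th => Q (ln r) th) 0 (2 * PI) (2 * PI * Re (g z))).
  replace (2 * PI * Re (g z)) with (RInt (fun th => Q (ln r) th) 0 (2 * PI)).
  { apply (RInt_correct (V := R_CompleteNormedModule)), EX; lra. }
  assert (J : forall s, s <= ln r -> RInt (fun th => Q (ln r) th) 0 (2 * PI) = RInt (fun th => Q s th) 0 (2 * PI)).
  { intros s Hs. pose proof (goursat_rectangle P Q s (ln r) 0 (2 * PI) Hs ltac:(lra) (HF s)) as E.
    unfold boundary_int in E.
    replace (RInt (fun x => P x (2 * PI)) s (ln r)) with (RInt (fun x => P x 0) s (ln r)) in E; [lra|].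
    apply RInt_ext. intros x _. unfold P, G, Cexp. simpl.
    rewrite cos_2PI, sin_2PI, cos_0, sin_0. reflexivity. }
  apply Rminus_diag_uniq, Rabs_eq_0, Rle_antisym; [|apply Rabs_pos].
  apply le_epsilon. intros e He. rewrite Rplus_0_l.
  destruct (ex_cderive_continuous g z) with (eps := e / (2 * PI)) as (d & Hd & Hc).
  { apply Hg. replace (z - z)%C with (RtoC 0) by ring. rewrite Cmod_0; lra. }
  { apply Rdiv_lt_0_compat; lra. }
  set (s := Rmin (ln r) (ln (d / 2))).
  rewrite (J s) by apply Rmin_l.
  replace (2 * PI * Re (g z)) with (Re (g z) * (2 * PI - 0)) by ring.
  eapply Rle_trans. apply (RInt_near_const _ _ _ _ (e / (2 * PI))). lra.
  apply EX, Rmin_l.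
  { intros th _. unfold Q, G.
    replace (Re (g (z + Cexp (s, th))%C) - Re (g z)) with (Re (g (z + Cexp (s, th)) - g z)%C) by (unfold Re, Im; simpl; ring).
    eapply Rle_trans. apply re_le_Cmod. left. apply Hc.
    replace (z + Cexp (s, th) - z)%C with (Cexp (s, th)) by ring. rewrite Cmod_Cexp. simpl.
    apply Rle_lt_trans with (exp (ln (d / 2))).
    - assert (T : s <= ln (d / 2)) by apply Rmin_r.
      destruct T as [T| ->]; [left; apply exp_increasing; trivial|lra].
    - rewrite exp_ln; lra. }
  right. field. lra.
Qed.

(** Since cos^2 has mean 1/2, the square costs an extra d r^2 / 2 compared with its value at the
    centre: this is the strict gain of the barrier. [H] below is the explicit antiderivative. *)
Lemma circular_mean_quadratic (S b d s r : R) :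
  is_RInt (fun th => S - b * (s + r * cos th) - d * (s + r * cos th) ^ 2) 0 (2 * PI)
    (2 * PI * (S - b * s - d * s ^ 2 - d * r ^ 2 / 2)).
Proof.
  set (H := fun th => (S - b * s - d * s ^ 2 - d * r ^ 2 / 2) * th - (b * r + 2 * d * s * r) * sin th
     - d * r ^ 2 / 2 * (sin th * cos th)).
  replace (2 * PI * _) with (minus (H (2 * PI)) (H 0)).
  2:{ unfold H, minus, plus, opp; simpl. rewrite cos_2PI, sin_2PI, cos_0, sin_0. ring. }
  apply (is_RInt_derive (V := R_CompleteNormedModule)).
  - intros x _. unfold H. auto_derive; trivial. assert (T := sin2_cos2 x). unfold Rsqr in T.
    replace (sin x * - (1 * sin x)) with (cos x * cos x - 1) by lra. field_simplify. 
    replace (sin x ^ 2) with (1 - cos x ^ 2) by nra. field.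
  - intros x _. apply (ex_derive_continuous (K := R_AbsRing) (V := R_NormedModule)). auto_derive. trivial.
Qed.

(** The bound exp (- Re z) tends to 1 at the imaginary axis and stands in for boundary values; [B]
    takes over far to the left, where that bound is useless. *)
Definition half_plane_controlled (K : C -> C) (B : R) : Prop := forall z, Re z < 0 ->
  ex_cderive K z /\ Cmod (K z) <= exp (- Re z) /\ Cmod (K z) <= B.

(* The quadratic term makes the barrier strictly subharmonic, so the mean value
   property at a near-maximizer already gives a contradiction; no compactness is needed. *)
Lemma strip_bound (K : C -> C) (B A rho d : R) (z : C) : half_plane_controlled K B ->
  0 < A -> 0 < rho -> 0 < d -> - A < Re z < 0 ->
  Cmod (K z) + B / A * Re z + d * Re z ^ 2 <= exp rho + B / A * rho + d * A ^ 2.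
Proof.
  intros HK0 HA Hrho Hd Hz.
  assert (K_bound : forall v, Re v < 0 -> Cmod (K v) <= B) by (intros v Hv; apply HK0; trivial).
  assert (HB : 0 <= B) by (eapply Rle_trans; [apply Cmod_ge_0|apply (K_bound z); lra]).
  (* With this slope the linear term equals - B on the left edge and absorbs the bound [B] there. On
     the right edge exp rho does the work, so values above [M] occur only at distance at least [rho]
     from both edges. *)
  set (b := B / A). assert (Hb : 0 <= b) by (apply Rle_div_r; lra).
  assert (HbA : b * A = B) by (unfold b; field; lra).
  set (M := exp rho + b * rho + d * A ^ 2).
  set (m := fun z => Cmod (K z) + b * Re z + d * Re z ^ 2).
  change (m z <= M). apply Rnot_lt_le. intros HM.
  assert (Hsq : forall w, - A < Re w < 0 -> d * Re w ^ 2 <= d * A ^ 2).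
  { intros w Hw. apply Rmult_le_compat_l. lra. nra. }
  destruct (completeness (fun v => exists w, - A < Re w < 0 /\ v = m w)) as [S [HS1 HS2]].
  { exists (B + d * A ^ 2). intros v (w & Hw & ->). unfold m.
    assert (T1 := K_bound w ltac:(lra)). assert (T2 := Hsq w Hw). nra. }
  { exists (m z), z. auto. }
  assert (HSM : M < S). { apply Rlt_le_trans with (m z); trivial. apply HS1. exists z; auto. }
  set (r := rho / 2).
  assert (Hr : 0 < d * r ^ 2 / 2).
  { apply Rdiv_lt_0_compat; [|lra]. apply Rmult_lt_0_compat; trivial. apply pow_lt. unfold r; lra. }
  assert (HE : exists w, - A < Re w < 0 /\ Rmax M (S - d * r ^ 2 / 2) < m w).
  { apply NNPP. intros Hn.
    assert (S <= Rmax M (S - d * r ^ 2 / 2)).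
    { apply HS2. intros v (w & Hw & ->). apply Rnot_lt_le. intros Hl. apply Hn. exists w. auto. }
    destruct (Rmax_case_strong M (S - d * r ^ 2 / 2) (fun x => S <= x -> False)); lra. }
  destruct HE as (w & Hw & Hm).
  assert (Hm1 : M < m w) by (eapply Rle_lt_trans; [apply Rmax_l|exact Hm]).
  assert (Hm2 : S - d * r ^ 2 / 2 < m w) by (eapply Rle_lt_trans; [apply Rmax_r|exact Hm]).
  clear Hm HM.
  assert (Tb := K_bound w ltac:(lra)). assert (Te : Cmod (K w) <= exp (- Re w)) by (apply HK0; lra). assert (Ts := Hsq w Hw).
  assert (Hexp := exp_pos rho).
  assert (W1 : Re w <= - rho).
  { apply Rnot_lt_le. intros Hc.
    assert (exp (- Re w) < exp rho) by (apply exp_increasing; lra).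
    unfold m, M in Hm1. nra. }
  assert (W2 : - A + rho <= Re w).
  { apply Rnot_lt_le. intros Hc. unfold m, M in Hm1. nra. }
  assert (HK : 0 < Cmod (K w)). { unfold m, M in Hm1. nra. }
  assert (Hr0 : 0 < r) by (unfold r; lra).
  (* The constant factor rotates [K] so that the real part at the centre is |K w|^2; the mean value
     property of a real part thus yields the sub-mean value property of the modulus. *)
  assert (MV : is_RInt (fun th => Re (Cconj (K w) * K (w + Cexp (ln r, th)))%C) 0 (2 * PI)
     (2 * PI * Re (Cconj (K w) * K w)%C)).
  { apply (mean_value (fun v => Cconj (K w) * K v)%C); trivial. intros v Hv.
    apply ex_cderive_mult. apply ex_cderive_const. apply HK0.
    assert (T := re_le_Cmod (v - w)%C). apply Rabs_le_between in T.
    replace (Re (v - w)%C) with (Re v - Re w) in T by (unfold Re, Im; simpl; ring). unfold r in *; lra. }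
  assert (HP := PI_RGT_0).
  assert (CM := is_RInt_scal _ _ _ (Cmod (K w)) _ (circular_mean_quadratic S b d (Re w) r)).
  assert (HL : 2 * PI * Re (Cconj (K w) * K w)%C <=
    Cmod (K w) * (2 * PI * (S - b * Re w - d * Re w ^ 2 - d * r ^ 2 / 2))).
  { assert (H2P : 0 <= 2 * PI) by lra. apply (is_RInt_le _ _ _ _ _ _ H2P MV CM). intros th _.
    set (v := (w + Cexp (ln r, th))%C).
    assert (Hv : Re v = Re w + r * cos th) by (unfold v; rewrite re_plus; simpl; rewrite exp_ln; trivial).
    assert (Hv2 : - A < Re v < 0). { rewrite Hv. assert (T := COS_bound th). unfold r in *. assert (- (rho / 2) <= rho / 2 * cos th <= rho / 2) by (split; nra). lra. }
    change (Re (Cconj (K w) * K v)%C <= Cmod (K w) * (S - b * (Re w + r * cos th) - d * (Re w + r * cos th) ^ 2)).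
    rewrite <- Hv. eapply Rle_trans. apply Rle_abs. eapply Rle_trans. apply re_le_Cmod.
    rewrite Cmod_mult, Cmod_conj. apply Rmult_le_compat_l. lra.
    assert (T : m v <= S) by (apply HS1; exists v; auto). unfold m in T. lra. }
  replace (Re (Cconj (K w) * K w)%C) with (Cmod (K w) ^ 2) in HL.
  2:{ rewrite Cmod2_alt. unfold Re, Im; simpl. ring. }
  assert (HL2 : Cmod (K w) <= S - b * Re w - d * Re w ^ 2 - d * r ^ 2 / 2).
  { apply (Rmult_le_reg_l (2 * PI * Cmod (K w))). nra. simpl in *. lra. }
  unfold m in Hm2. lra.
Qed.

Lemma left_half_plane_max (K : C -> C) (B : R) (z : C) : half_plane_controlled K B -> Re z < 0 -> Cmod (K z) <= 1.
Proof.
  intros HK Hz. apply le_epsilon. intros eps Heps.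
  assert (HB : 0 <= B) by (eapply Rle_trans; [apply Cmod_ge_0|apply (HK z); lra]).
  set (e := eps / 3). assert (He : 0 < e) by (unfold e; lra).
  set (rho := Rmin 1 (ln (1 + e))).
  assert (Hrho : 0 < rho).
  { apply Rmin_pos. lra. rewrite <- ln_1. apply ln_increasing; lra. }
  assert (Hr1 : rho <= 1) by apply Rmin_l.
  assert (Hr2 : exp rho <= 1 + e).
  { rewrite <- (exp_ln (1 + e)) by lra. assert (T : rho <= ln (1 + e)) by apply Rmin_r.
    destruct T as [T| ->]; [left; apply exp_increasing; trivial|lra]. }
  (* The first term makes the linear part of the barrier, B (rho - Re z) / A with rho <= 1, at most
     [e]; the rest puts [z] inside the strip. With d = e / A^2 the quadratic part costs another [e],
     and exp rho <= 1 + e the third. *)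
  set (A := B * (1 - Re z) / e + 1 - Re z).
  assert (HA1 : 0 <= B * (1 - Re z) / e) by (apply Rle_div_r; nra).
  assert (HA : 0 < A) by (unfold A; lra).
  assert (HA2 : B * (1 - Re z) <= e * A).
  { unfold A. replace (e * (B * (1 - Re z) / e + 1 - Re z)) with (B * (1 - Re z) + e * (1 - Re z)) by (field; lra). nra. }
  assert (H := strip_bound K B A rho (e / A ^ 2) z HK HA Hrho).
  assert (HA3 : 0 < A ^ 2) by (apply pow_lt; trivial).
  assert (Hd : 0 < e / A ^ 2) by (apply Rdiv_lt_0_compat; lra).
  specialize (H Hd ltac:(unfold A; lra)).
  replace (e / A ^ 2 * A ^ 2) with e in H by (field; lra).
  assert (B / A * (1 - Re z) <= e).
  { replace (B / A * (1 - Re z)) with (B * (1 - Re z) / A) by (field; lra). apply Rle_div_l; lra. }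
  assert (Hb : 0 <= B / A) by (apply Rle_div_r; lra).
  assert (0 <= e / A ^ 2 * Re z ^ 2) by (apply Rmult_le_pos; [lra|apply pow2_ge_0]).
  unfold e in *. nra.
Qed.

(** * Schwarz-Pick *)

(** This identity converts the pseudo-hyperbolic quotient |a - b| / |a - conj b| into |a - b|^2 /
    (Im a Im b), of which it is a monotone function. *)
Lemma Cmod_minus_conj (a b : C) :
  Cmod (a - Cconj b)%C ^ 2 = Cmod (a - b)%C ^ 2 + 4 * (Im a * Im b).
Proof. rewrite !Cmod2_alt. unfold Re, Im; simpl. ring. Qed.

Lemma Cmod_le_sqr (a b : C) : Cmod a ^ 2 <= Cmod b ^ 2 -> Cmod a <= Cmod b.
Proof. intros H. apply Rsqr_incr_0_var; [rewrite !Rsqr_pow2; exact H|apply Cmod_ge_0]. Qed.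

(** The inverse of z -> (z - w) / (z - conj w): it maps the unit disc to the half-plane and 0 to
    [w]. *)
Definition cayley_inv (w e : C) : C := ((w - Cconj w * e) / (1 - e))%C.

Lemma one_minus_nz (e : C) : Cmod e < 1 -> (1 - e)%C <> 0.
Proof.
  intros H E. replace e with (RtoC 1) in H. rewrite Cmod_1 in H; lra.
  replace e with (1 - (1 - e))%C by ring. rewrite E. ring.
Qed.

Lemma cayley_inv_H (w e : C) : inH w -> Cmod e < 1 -> inH (cayley_inv w e).
Proof.
  unfold inH. intros Hw He. assert (Hn := one_minus_nz e He).
  assert (Hm : 0 < Cmod (1 - e)%C ^ 2) by (apply pow_lt, Cmod_gt_0; trivial).
  assert (He2 : Cmod e ^ 2 < 1) by (assert (T := Cmod_ge_0 e); nra).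
  replace (Im (cayley_inv w e)) with (Im w * (1 - Cmod e ^ 2) / Cmod (1 - e)%C ^ 2).
  { apply Rdiv_lt_0_compat; nra. }
  rewrite Cmod2_alt in *. rewrite Cmod2_alt in *. unfold cayley_inv. unfold Re, Im in *. simpl in *.
  field. nra.
Qed.

Lemma cayley_inv_minus (w e : C) : Cmod e < 1 ->
  (cayley_inv w e - w)%C = (e * (w - Cconj w) / (1 - e))%C.
Proof. intros He. assert (Hn := one_minus_nz e He). unfold cayley_inv. field. exact Hn. Qed.

Lemma Cmod_minus_self_conj (w : C) : inH w -> Cmod (w - Cconj w)%C = 2 * Im w.
Proof.
  unfold inH; intros H. rewrite <- (Rabs_pos_eq (2 * Im w)) by lra.
  replace (w - Cconj w)%C with (RtoC (2 * Im w) * Ci)%C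
    by (apply injective_projections; unfold Im; simpl; ring).
  rewrite Cmod_mult, Cmod_R, Cmod_Ci. ring.
Qed.

Lemma Cmod_minus_conj_ge (a b : C) : 0 <= Im a -> 0 <= Im b -> Im b <= Cmod (a - Cconj b)%C.
Proof.
  intros Ha Hb. eapply Rle_trans; [|apply Rabs_im_le_Cmod].
  rewrite Rabs_pos_eq; unfold Im in *; simpl; lra.
Qed.

(** The Schwarz quotient of [f] in Cayley coordinates at [w] and [f w], lifted by e = Cexp s. The
    numerator has modulus at most 1, which gives the bound 1/|e|; near e = 0 differentiability of
    [f] at [w] keeps the quotient bounded. *)
Lemma schwarz_quotient_controlled (f : C -> C) (w : C) :
  (forall z, inH z -> ex_cderive f z) -> (forall z, inH z -> inH (f z)) -> inH w ->
  exists B, half_plane_controlled (fun s =>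
    (f (cayley_inv w (Cexp s)) - f w) / (f (cayley_inv w (Cexp s)) - Cconj (f w)) / Cexp s)%C B.
Proof.
  intros Hd Hf Hw.
  destruct (Hd w Hw) as [l Hl]. rewrite is_cderive_iff in Hl.
  destruct (Hl 1 Rlt_0_1) as (d & Hd0 & Hl1).
  assert (Hwp : 0 < Im w) by exact Hw. assert (Hfw : 0 < Im (f w)) by (apply Hf; exact Hw).
  (* For |e| < eta one has |1 - e| >= 1/2, so |Z - w| <= 4 Im w |e| < d and the first-order estimate
     at [w] applies. [B1] collects the resulting constants; the last factor is the lower bound Im (f
     w) of the denominator. *)
  set (eta := Rmin (1 / 2) (d / (4 * Im w))).
  assert (Heta : 0 < eta). { apply Rmin_pos. lra. apply Rdiv_lt_0_compat; lra. }
  set (B1 := (Cmod l + 1) * (4 * Im w) / Im (f w)).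
  exists (Rmax B1 (/ eta)). intros s Hs.
  assert (He : Cmod (Cexp s) < 1) by (rewrite Cmod_Cexp, <- exp_0; apply exp_increasing; trivial).
  assert (Hep : 0 < Cmod (Cexp s)) by (rewrite Cmod_Cexp; apply exp_pos).
  assert (Hen := Cexp_nz s).
  assert (Hn := one_minus_nz _ He).
  assert (HZ := cayley_inv_H w _ Hw He).
  assert (HZd := cayley_inv_minus w _ He).
  assert (HD : ex_cderive (fun s => cayley_inv w (Cexp s)) s).
  { unfold cayley_inv. apply ex_cderive_div; trivial.
    - apply ex_cderive_minus. apply ex_cderive_const. apply ex_cderive_mult. apply ex_cderive_const. apply ex_cderive_Cexp.
    - apply ex_cderive_minus. apply ex_cderive_const. apply ex_cderive_Cexp. }
  set (Z := cayley_inv w (Cexp s)) in *.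
  assert (HfZ : 0 < Im (f Z)) by (apply Hf; exact HZ).
  assert (Hden : Im (f w) <= Cmod (f Z - Cconj (f w))%C) by (apply Cmod_minus_conj_ge; lra).
  assert (Hdn : (f Z - Cconj (f w))%C <> 0) by (apply Cmod_gt_0; lra).
  assert (HK : Cmod ((f Z - f w) / (f Z - Cconj (f w)) / Cexp s)%C
     = Cmod (f Z - f w)%C / (Cmod (f Z - Cconj (f w))%C * Cmod (Cexp s))).
  { rewrite !Cmod_div by trivial. field. lra. }
  assert (HK1 : Cmod ((f Z - f w) / (f Z - Cconj (f w)) / Cexp s)%C <= / Cmod (Cexp s)).
  { rewrite HK. apply Rle_div_l. apply Rmult_lt_0_compat; lra.
    replace (/ Cmod (Cexp s) * _) with (Cmod (f Z - Cconj (f w))%C) by (field; lra).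
    apply Cmod_le_sqr. rewrite Cmod_minus_conj. nra. }
  split; [|split].
  - apply ex_cderive_div; trivial; [|apply ex_cderive_Cexp].
    assert (HC : ex_cderive (fun s => f (cayley_inv w (Cexp s))) s).
    { apply (ex_cderive_comp f (fun s => cayley_inv w (Cexp s))); trivial. apply Hd; exact HZ. }
    apply ex_cderive_div; trivial; (apply ex_cderive_minus; [exact HC|apply ex_cderive_const]).
  - rewrite exp_Ropp, <- Cmod_Cexp. exact HK1.
  - destruct (Rle_dec eta (Cmod (Cexp s))) as [Hc|Hc].
    { eapply Rle_trans; [exact HK1|]. eapply Rle_trans; [|apply Rmax_r].
      apply Rinv_le_contravar; trivial. }
    eapply Rle_trans; [|apply Rmax_l].
    apply Rnot_le_lt in Hc. unfold eta in Hc. apply Rmin_Rgt in Hc as [Hc1 Hc2].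
    assert (H1e : 1 / 2 <= Cmod (1 - Cexp s)%C).
    { assert (T := Cmod_triangle (1 - Cexp s) (Cexp s)).
      replace (1 - Cexp s + Cexp s)%C with (RtoC 1) in T by ring. rewrite Cmod_1 in T. lra. }
    assert (HZs : Cmod (Z - w)%C <= 4 * Im w * Cmod (Cexp s)).
    { rewrite HZd, Cmod_div, Cmod_mult, Cmod_minus_self_conj by trivial.
      apply Rle_div_l; [lra|]. assert (T := Rmult_le_compat_l (4 * Im w * Cmod (Cexp s)) _ _ ltac:(nra) H1e). lra. }
    assert (HZ3 : Cmod (Z - w)%C < d).
    { eapply Rle_lt_trans. exact HZs. apply Rlt_div_r in Hc2; lra. }
    specialize (Hl1 Z HZ3).
    assert (HfL : Cmod (f Z - f w)%C <= (Cmod l + 1) * Cmod (Z - w)%C).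
    { replace (f Z - f w)%C with ((f Z - f w - l * (Z - w)) + l * (Z - w))%C by ring.
      eapply Rle_trans. apply Cmod_triangle. rewrite Cmod_mult. lra. }
    rewrite HK. apply Rle_div_l. apply Rmult_lt_0_compat; lra.
    assert (Hl0 := Cmod_ge_0 l).
    apply Rle_trans with ((Cmod l + 1) * (4 * Im w * Cmod (Cexp s))). nra.
    replace (B1 * _) with ((Cmod l + 1) * (4 * Im w * Cmod (Cexp s)) * (Cmod (f Z - Cconj (f w))%C / Im (f w)))
      by (unfold B1; field; lra).
    rewrite <- (Rmult_1_r ((Cmod l + 1) * (4 * Im w * Cmod (Cexp s)))) at 1.
    apply Rmult_le_compat_l.
    { apply Rmult_le_pos; [lra|]. nra. }
    apply Rle_div_r; lra.
Qed.

Lemma schwarz_pick (f : C -> C) :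
  (forall z, inH z -> ex_cderive f z) -> (forall z, inH z -> inH (f z)) ->
  forall z w, inH z -> inH w ->
  Cmod (f z - f w)%C ^ 2 * (Im z * Im w) <= Cmod (z - w)%C ^ 2 * (Im (f z) * Im (f w)).
Proof.
  intros Hd Hf z w Hz Hw.
  assert (Hzp : 0 < Im z) by exact Hz. assert (Hwp : 0 < Im w) by exact Hw.
  assert (Hfz : 0 < Im (f z)) by (apply Hf; exact Hz).
  assert (Hfw : 0 < Im (f w)) by (apply Hf; exact Hw).
  destruct (Req_dec (Cmod (z - w)%C) 0) as [E|E].
  { apply Cmod_eq_0, Ceq_minus in E. subst z. replace (f w - f w)%C with (RtoC 0) by ring.
    replace (w - w)%C with (RtoC 0) by ring. rewrite Cmod_0. simpl; lra. }
  assert (E0 : 0 < Cmod (z - w)%C) by (assert (T := Cmod_ge_0 (z - w)%C); lra).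
  assert (HD : 0 < Cmod (z - Cconj w)%C).
  { assert (T := Cmod_minus_conj_ge z w ltac:(lra) ltac:(lra)). lra. }
  assert (HDn : (z - Cconj w)%C <> 0) by (apply Cmod_gt_0; trivial).
  set (q := ((z - w) / (z - Cconj w))%C).
  assert (Hqm : Cmod q = Cmod (z - w)%C / Cmod (z - Cconj w)%C) by (apply Cmod_div; trivial).
  assert (Hq0 : 0 < Cmod q) by (rewrite Hqm; apply Rdiv_lt_0_compat; trivial).
  assert (Hlt : Cmod (z - w)%C < Cmod (z - Cconj w)%C).
  { apply Rsqr_incrst_0; try apply Cmod_ge_0. rewrite !Rsqr_pow2, Cmod_minus_conj. nra. }
  assert (Hq1 : Cmod q < 1) by (rewrite Hqm; apply Rlt_div_l; lra).
  destruct (Cexp_polar q) as (s & Hs1 & Hs2). { apply Cmod_gt_0; trivial. }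
  destruct (schwarz_quotient_controlled f w Hd Hf Hw) as (B & HB).
  assert (Hs : Re s < 0) by (rewrite Hs2, <- ln_1; apply ln_increasing; trivial).
  assert (HZ : cayley_inv w (Cexp s) = z).
  { rewrite Hs1. unfold cayley_inv, q. 
    assert (Hwn : (w - Cconj w)%C <> 0). { apply Cmod_gt_0. rewrite Cmod_minus_self_conj; trivial. lra. }
    field. split; trivial. replace (z - Cconj w - (z - w))%C with (w - Cconj w)%C by ring. trivial. }
  assert (HK := left_half_plane_max _ B s HB Hs). simpl in HK. rewrite HZ, Hs1 in HK.
  assert (Hden : Im (f w) <= Cmod (f z - Cconj (f w))%C) by (apply Cmod_minus_conj_ge; lra).
  rewrite !Cmod_div in HK; try (apply Cmod_gt_0; lra).
  apply (proj1 (Rle_div_l _ _ _ Hq0)) in HK.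
  assert (Hdp : 0 < Cmod (f z - Cconj (f w))%C) by lra.
  apply (proj1 (Rle_div_l _ _ _ Hdp)) in HK.
  rewrite Rmult_1_l, Hqm in HK.
  assert (HK2 : Cmod (f z - f w)%C * Cmod (z - Cconj w)%C <= Cmod (z - w)%C * Cmod (f z - Cconj (f w))%C).
  { apply Rmult_le_compat_r with (r := Cmod (z - Cconj w)%C) in HK; [|lra].
    eapply Rle_trans. exact HK. right. field. lra. }
  assert (HK3 : Cmod (f z - f w)%C ^ 2 * Cmod (z - Cconj w)%C ^ 2 <= Cmod (z - w)%C ^ 2 * Cmod (f z - Cconj (f w))%C ^ 2).
  { rewrite <- !Rpow_mult_distr. apply pow_incr. split; trivial.
    apply Rmult_le_pos; apply Cmod_ge_0. }
  (* After expansion the product of the two squared differences appears on both sides and cancels;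
     what remains is the claim times 4. *)
  rewrite !Cmod_minus_conj in HK3. lra.
Qed.

(** Adding i d moves the values into the open half-plane, and the inequality, having no
    denominators, passes to the limit d -> 0. *)
Lemma schwarz_pick_closed (f : C -> C) :
  (forall z, inH z -> ex_cderive f z) -> (forall z, inH z -> 0 <= Im (f z)) ->
  forall z w, inH z -> inH w ->
  Cmod (f z - f w)%C ^ 2 * (Im z * Im w) <= Cmod (z - w)%C ^ 2 * (Im (f z) * Im (f w)).
Proof.
  intros Hd Hf z w Hz Hw.
  assert (H : forall d, 0 < d -> Cmod (f z - f w)%C ^ 2 * (Im z * Im w) <=
     Cmod (z - w)%C ^ 2 * ((Im (f z) + d) * (Im (f w) + d))).
  { intros d Hd0.
    assert (HI : forall v, Im (f v + RtoC d * Ci)%C = Im (f v) + d) by (intros; unfold Im; simpl; ring).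
    assert (T := schwarz_pick (fun v => f v + RtoC d * Ci)%C). simpl in T.
    rewrite <- !HI. 
    replace (f z - f w)%C with (f z + RtoC d * Ci - (f w + RtoC d * Ci))%C by ring.
    apply T; trivial.
    - intros v Hv. apply ex_cderive_plus; [apply Hd; trivial|apply ex_cderive_const].
    - intros v Hv. unfold inH. rewrite HI. specialize (Hf v Hv). lra. }
  set (N := Cmod (z - w)%C ^ 2) in *. assert (HN : 0 <= N) by apply pow2_ge_0.
  assert (H1 := Hf z Hz). assert (H2 := Hf w Hw).
  set (a := Im (f z)) in *. set (b := Im (f w)) in *.
  apply le_epsilon. intros e He.
  assert (HQ : 0 < N * (a + b + 1) + 1) by nra.
  set (d := Rmin 1 (e / (N * (a + b + 1) + 1))).
  assert (Hd0 : 0 < d). { apply Rmin_pos. lra. apply Rdiv_lt_0_compat; trivial. }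
  eapply Rle_trans. apply (H d Hd0).
  assert (Hd1 : d <= 1) by apply Rmin_l.
  assert (Hd2 : d * (N * (a + b + 1) + 1) <= e).
  { apply Rle_div_r; trivial. apply Rmin_r. }
  assert (d * d <= d) by nra.
  replace (N * ((a + d) * (b + d))) with (N * (a * b) + N * (a + b) * d + N * (d * d)) by ring.
  assert (N * (d * d) <= N * d) by (apply Rmult_le_compat_l; trivial).
  nra.
Qed.

(** * Contractions of the half-plane *)

(** The quantity |z - w|^2 / (Im z Im w), increasing in the hyperbolic distance, does not grow under
    [f]. The multiplied-out form still makes sense when [f] takes real values. *)
Definition pick (f : C -> C) : Prop := forall z w, inH z -> inH w ->
  Cmod (f z - f w)%C ^ 2 * (Im z * Im w) <= Cmod (z - w)%C ^ 2 * (Im (f z) * Im (f w)).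

Lemma Cmod_minus_ge (a b : C) : Cmod a - Cmod b <= Cmod (a - b)%C.
Proof.
  assert (T := Cmod_triangle (a - b) b). replace (a - b + b)%C with a in T by ring. lra.
Qed.

Lemma Cmod_minus_le (a b : C) : Cmod (a - b)%C <= Cmod a + Cmod b.
Proof. unfold Cminus. eapply Rle_trans. apply Cmod_triangle. rewrite Cmod_opp. lra. Qed.

Lemma im_le_Cmod (z : C) : Im z <= Cmod z.
Proof. eapply Rle_trans; [apply Rle_abs|apply Rabs_im_le_Cmod]. Qed.

(* If [Im (f z) < Im z], the contraction property between [z] and the orbit would make
   [Im (w n) / |w n|^2] eventually nondecreasing, although it tends to 0. *)
Lemma julia (f : C -> C) (w : nat -> C) (z : C) :
  pick f -> (forall n, inH (w n)) -> (forall n, w (S n) = f (w n)) ->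
  (forall M, exists N, forall n, (N <= n)%nat -> M <= Cmod (w n)) ->
  inH z -> inH (f z) -> Im z <= Im (f z).
Proof.
  intros Hp Hw Hs Hinf Hz Hfz. unfold inH in *.
  apply Rnot_lt_le. intros Hlt.
  set (y := Im z) in *. set (y' := Im (f z)) in *.
  (* Chosen so that (1 - eta) y = (1 + eta) y'. Once |z| and |f z| are below eta/3 times the moduli
     of the orbit, replacing squared distances by squared moduli costs at most the factors 1 + eta
     and 1 - eta, which then cancel exactly against y and y'. *)
  set (eta := (y - y') / (y + y')).
  assert (Heta : 0 < eta) by (apply Rdiv_lt_0_compat; lra).
  assert (Heta1 : (1 - eta) * y = (1 + eta) * y') by (unfold eta; field; lra).
  assert (Heta2 : eta < 1) by (apply Rlt_div_l; lra).
  assert (HA := Cmod_ge_0 z). assert (HA' := Cmod_ge_0 (f z)).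
  set (T := 3 * (Cmod z + Cmod (f z) + 1) / eta).
  destruct (Hinf T) as [N HN].
  assert (HT : forall n, (N <= n)%nat -> 3 * (Cmod z + Cmod (f z) + 1) <= eta * Cmod (w n)).
  { intros n Hn. specialize (HN n Hn). unfold T in HN. apply (Rle_div_l _ _ _ Heta) in HN. lra. }
  assert (Hmono : forall n, (N <= n)%nat -> Im (w n) * Cmod (w (S n)) ^ 2 <= Im (w (S n)) * Cmod (w n) ^ 2).
  { intros n Hn. assert (H1 := HT n Hn). assert (H2 := HT (S n) ltac:(lia)).
    assert (P := Hp z (w n) Hz (Hw n)). rewrite <- Hs in P. fold y y' in P.
    set (W := Cmod (w n)) in *. set (W' := Cmod (w (S n))) in *.
    assert (B1 : Cmod (z - w n)%C ^ 2 <= (1 + eta) * W ^ 2).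
    { assert (U := Cmod_minus_le z (w n)). fold W in U.
      apply Rle_trans with ((Cmod z + W) ^ 2). apply pow_incr. split; trivial; apply Cmod_ge_0.
      assert (0 <= W) by apply Cmod_ge_0. nra. }
    assert (B2 : (1 - eta) * W' ^ 2 <= Cmod (f z - w (S n))%C ^ 2).
    { assert (U := Cmod_minus_ge (w (S n)) (f z)). fold W' in U.
      replace (Cmod (f z - w (S n))%C) with (Cmod (w (S n) - f z)%C)
        by (rewrite <- Cmod_opp; f_equal; ring).
      assert (0 <= W') by apply Cmod_ge_0. assert (0 <= W' - Cmod (f z)) by nra.
      apply Rle_trans with ((W' - Cmod (f z)) ^ 2); [nra|]. apply pow_incr. lra. }
    assert (b1 := Hw n). assert (b2 := Hw (S n)). cbv beta in b1, b2.
    assert (E : ((1 - eta) * W' ^ 2) * (y * Im (w n)) <= ((1 + eta) * W ^ 2) * (y' * Im (w (S n)))).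
    { eapply Rle_trans; [|eapply Rle_trans; [exact P|]].
      - apply Rmult_le_compat_r; trivial. nra.
      - apply Rmult_le_compat_r; trivial. nra. }
    replace ((1 - eta) * W' ^ 2 * (y * Im (w n))) with (((1 - eta) * y) * (Im (w n) * W' ^ 2)) in E by ring.
    replace ((1 + eta) * W ^ 2 * (y' * Im (w (S n)))) with (((1 + eta) * y') * (Im (w (S n)) * W ^ 2)) in E by ring.
    rewrite Heta1 in E. apply Rmult_le_reg_l in E; trivial. nra. }
  assert (HW : forall n, (N <= n)%nat -> 0 < Cmod (w n)).
  { intros n Hn. specialize (Hw n). assert (U := im_le_Cmod (w n)). lra. }
  assert (HN0 := HW N (Nat.le_refl N)).
  assert (Hlow : forall n, (N <= n)%nat -> Im (w N) / Cmod (w N) ^ 2 <= Im (w n) / Cmod (w n) ^ 2).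
  { intros n Hn. induction Hn as [|n Hn IH]. lra.
    eapply Rle_trans. exact IH. specialize (Hmono n Hn).
    assert (U1 := HW n Hn). assert (U2 := HW (S n) ltac:(lia)).
    apply Rle_div_l. apply pow_lt; trivial.
    replace (Im (w (S n)) / Cmod (w (S n)) ^ 2 * Cmod (w n) ^ 2)
      with ((Im (w (S n)) * Cmod (w n) ^ 2) / Cmod (w (S n)) ^ 2) by (field; lra).
    apply (proj1 (Rle_div_r _ _ _ (pow_lt _ 2 U2))). exact Hmono. }
  set (a := Im (w N) / Cmod (w N) ^ 2) in *.
  assert (Ha : 0 < a) by (apply Rdiv_lt_0_compat; [apply Hw|apply pow_lt; trivial]).
  destruct (Hinf (/ a + 1)) as [N2 HN2].
  specialize (HN2 (max N N2) ltac:(lia)). specialize (Hlow (max N N2) ltac:(lia)).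
  specialize (HW (max N N2) ltac:(lia)).
  set (W := Cmod (w (max N N2))) in *. assert (U := im_le_Cmod (w (max N N2))). fold W in U.
  apply (proj2 (Rle_div_r _ _ _ (pow_lt _ 2 HW))) in Hlow.
  assert (a * W <= 1) by nra.
  assert (a * (/ a + 1) <= a * W) by (apply Rmult_le_compat_l; lra).
  rewrite Rmult_plus_distr_l, Rinv_r in H0 by lra. lra.
Qed.

(** Fix z0 where Im p / Im is tiny. In a Stolz angle [pick] between z and z0 gives D^2 <= a Im (p
    z), with D = |p z - p z0| and a a small multiple of |z|. As Im (p z) <= D + |p z0|, this bounds
    D itself by 2 a + |p z0|. *)
Lemma pick_sublinear (p : C -> C) :
  pick p -> (forall z, inH z -> 0 <= Im (p z)) ->
  (forall e, 0 < e -> exists z, inH z /\ Im (p z) <= e * Im z) ->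
  forall M e, 0 < M -> 0 < e -> exists T, 0 < T /\ forall z, inH z -> Cmod z <= M * Im z -> T <= Cmod z ->
    Cmod (p z) <= e * Cmod z.
Proof.
  intros Hp Him Hinf M e HM He.
  set (e' := e / (16 * M)). assert (He' : 0 < e') by (apply Rdiv_lt_0_compat; lra).
  destruct (Hinf e' He') as (z0 & Hz0 & Hp0).
  assert (N0 := Cmod_ge_0 (p z0)). assert (N1 := Cmod_ge_0 z0).
  assert (N2 : 0 <= 4 * Cmod (p z0) / e) by (apply Rle_div_r; lra).
  exists (1 + Cmod z0 + 4 * Cmod (p z0) / e). split. lra.
  intros z Hz HzM HzT.
  assert (P := Hp z z0 Hz Hz0). unfold inH in *.
  set (D := Cmod (p z - p z0)%C) in *.
  assert (HD : 0 <= D) by apply Cmod_ge_0.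
  assert (Hd2 : Cmod (z - z0)%C ^ 2 <= 4 * Cmod z * (M * Im z)).
  { assert (T := Cmod_minus_le z z0). apply Rle_trans with ((2 * Cmod z) ^ 2).
    apply pow_incr; split; [apply Cmod_ge_0|lra]. nra. }
  assert (Hq := Him z Hz).
  assert (HD2 : D ^ 2 <= (4 * M * e' * Cmod z) * Im (p z)).
  { apply (Rmult_le_reg_r (Im z * Im z0)). nra.
    eapply Rle_trans. exact P.
    apply Rle_trans with (4 * Cmod z * (M * Im z) * (Im (p z) * (e' * Im z0))).
    - apply Rmult_le_compat; trivial. apply pow2_ge_0. apply Rmult_le_pos; [lra|apply Him; trivial].
      apply Rmult_le_compat_l; lra.
    - right; ring. }
  assert (Hip : Im (p z) <= D + Cmod (p z0)).
  { assert (T := im_le_Cmod (p z - p z0)%C). assert (T2 := im_le_Cmod (p z0)). fold D in T.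
    replace (Im (p z - p z0)%C) with (Im (p z) - Im (p z0)) in T by (unfold Im; simpl; ring). lra. }
  assert (Ha : 4 * M * e' * Cmod z = e / 4 * Cmod z) by (unfold e'; field; lra).
  rewrite Ha in HD2. set (a := e / 4 * Cmod z) in *.
  assert (Ha0 : 0 <= a) by (unfold a; nra).
  assert (HDf : D <= 2 * a + Cmod (p z0)).
  { apply Rnot_lt_le. intros Hc. 
    assert (D ^ 2 <= a * (D + Cmod (p z0))) by (eapply Rle_trans; [exact HD2|apply Rmult_le_compat_l; lra]).
    nra. }
  assert (HT2 : 4 * Cmod (p z0) <= e * Cmod z).
  { replace (4 * Cmod (p z0)) with (e * (4 * Cmod (p z0) / e)) by (field; lra).
    apply Rmult_le_compat_l; lra. }
  replace (p z) with ((p z - p z0) + p z0)%C by ring.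
  eapply Rle_trans. apply Cmod_triangle. fold D. unfold a in *. lra.
Qed.

Lemma sqrt_not_linear (a b c : R) (N : nat) : 0 < a ->
  ~ (forall n, (N <= n)%nat -> a * INR n + b <= c * sqrt (INR n)).
Proof.
  intros Ha H.
  destruct (nfloor_ex (((Rabs c + Rabs b + 1) / a) ^ 2)) as [k [_ Hk]]. apply pow2_ge_0.
  set (n := max N (S k)). specialize (H n ltac:(lia)).
  set (X := (Rabs c + Rabs b + 1) / a) in *.
  assert (Hc := Rabs_pos c). assert (Hb := Rabs_pos b).
  assert (HX : 0 < X) by (apply Rdiv_lt_0_compat; lra).
  assert (Hn : X ^ 2 <= INR n).
  { apply Rle_trans with (INR (S k)). rewrite S_INR; lra. apply le_INR; lia. }
  assert (Hn1 : 1 <= INR n) by (change 1 with (INR 1); apply le_INR; lia).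
  assert (Hs : X <= sqrt (INR n)) by (rewrite <- (sqrt_pow2 X) by lra; apply sqrt_le_1_alt; trivial).
  assert (Hs1 : 1 <= sqrt (INR n)) by (rewrite <- sqrt_1; apply sqrt_le_1_alt; trivial).
  assert (Hss := sqrt_sqrt (INR n) ltac:(lra)).
  set (s := sqrt (INR n)) in *. rewrite <- Hss in H.
  assert (HaX : a * X = Rabs c + Rabs b + 1) by (unfold X; field; lra).
  assert (c <= Rabs c) by apply Rle_abs. assert (- b <= Rabs b) by (rewrite <- Rabs_Ropp; apply Rle_abs).
  assert (E : a * X * s <= a * s * s).
  { apply Rmult_le_compat_r. lra. apply Rmult_le_compat_l; lra. }
  rewrite HaX in E. assert (c * s <= Rabs c * s) by (apply Rmult_le_compat_r; lra).
  assert (Rabs b <= Rabs b * s) by nra. lra.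
Qed.

Lemma iR_inH (r : R) : 0 < r -> inH (0, r).
Proof. trivial. Qed.

Lemma Cmod_iR (r : R) : 0 <= r -> Cmod (0, r) = r.
Proof.
  intros H. replace ((0, r) : C) with (RtoC r * Ci)%C by (apply injective_projections; simpl; ring).
  rewrite Cmod_mult, Cmod_R, Cmod_Ci, Rabs_pos_eq; lra.
Qed.

(** If r Im (F (i r)) exceeds (c + 1)^2 for one r, then once r <= sqrt n the orbit gains at least Im
    (w n) / n in height per step. So Im (w n) / n is eventually nondecreasing, which contradicts the
    square root bound. The final + 1 in [K] only secures positivity. *)
Lemma orbit_sqrt_bound (F : C -> C) (w : nat -> C) (c : R) (N : nat) :
  pick F -> (forall z, inH z -> 0 < Im (F z)) ->
  (forall n, inH (w n)) -> (forall n, w (S n) = w n + F (w n))%C ->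
  (forall n, (N <= n)%nat -> Cmod (w n) <= c * sqrt (INR n)) ->
  exists K, 0 < K /\ forall r, 0 < r -> r * Im (F (0, r)) <= K.
Proof.
  intros Hp Him Hw Hs Hc.
  exists ((c + 1) ^ 2 + 1). split. assert (T := pow2_ge_0 (c + 1)); lra.
  intros r Hr. apply Rnot_lt_le. intros HK.
  assert (HF : 0 < Im (F (0, r))) by (apply Him, iR_inH; trivial).
  (* the contraction property gives [Im (F z) >= r * Im (F (i r)) * Im z / |z + i r|^2] *)
  assert (Hlow : forall n, (c + 1) ^ 2 * Im (w n) <= (Im (w (S n)) - Im (w n)) * (Cmod (w n) + r) ^ 2).
  { intros n. assert (Hwn := Hw n). assert (P := Hp (w n) (0, r) Hwn (iR_inH r Hr)).
    assert (Hfw := Him _ Hwn). unfold inH in Hwn.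
    assert (P2 : Cmod (F (w n) - Cconj (F (0, r)))%C ^ 2 * (Im (w n) * r) <=
       Cmod (w n - Cconj (0, r))%C ^ 2 * (Im (F (w n)) * Im (F (0, r)))).
    { rewrite !Cmod_minus_conj. change (Im (0, r)) with r in *. lra. }
    assert (P3 : Im (F (0, r)) <= Cmod (F (w n) - Cconj (F (0, r)))%C) by (apply Cmod_minus_conj_ge; lra).
    assert (P4 : Cmod (w n - Cconj (0, r))%C <= Cmod (w n) + r).
    { eapply Rle_trans. apply Cmod_minus_le. rewrite Cmod_conj, Cmod_iR; lra. }
    assert (P5 : Im (F (0, r)) ^ 2 <= Cmod (F (w n) - Cconj (F (0, r)))%C ^ 2) by (apply pow_incr; lra).
    assert (P6 : Cmod (w n - Cconj (0, r))%C ^ 2 <= (Cmod (w n) + r) ^ 2) by (apply pow_incr; split; [apply Cmod_ge_0|lra]).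
    assert (P7 : Im (F (0, r)) ^ 2 * (Im (w n) * r) <= (Cmod (w n) + r) ^ 2 * (Im (F (w n)) * Im (F (0, r)))).
    { eapply Rle_trans; [|eapply Rle_trans; [exact P2|]]; apply Rmult_le_compat_r; trivial; nra. }
    assert (P8 : (r * Im (F (0, r))) * Im (w n) <= (Cmod (w n) + r) ^ 2 * Im (F (w n))).
    { apply (Rmult_le_reg_r (Im (F (0, r)))); trivial. lra. }
    rewrite (Hs n), im_plus. nra. }
  destruct (nfloor_ex (r ^ 2)) as [k [_ Hk]]. apply pow2_ge_0.
  set (N1 := max (max N (S k)) 1).
  assert (HN1 : forall n, (N1 <= n)%nat -> 1 <= INR n /\ r <= sqrt (INR n) /\ Cmod (w n) <= c * sqrt (INR n)).
  { intros n Hn. repeat split.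
    - change 1 with (INR 1). apply le_INR; lia.
    - rewrite <- (sqrt_pow2 r) by lra. apply sqrt_le_1_alt.
      apply Rle_trans with (INR (S k)). rewrite S_INR; lra. apply le_INR; lia.
    - apply Hc; lia. }
  assert (Hc0 : 0 < c).
  { destruct (HN1 N1 (Nat.le_refl _)) as (A1 & A2 & A3). assert (T := Hw N1). unfold inH in T.
    assert (T2 := im_le_Cmod (w N1)). nra. }
  assert (Hstep : forall n, (N1 <= n)%nat -> Im (w n) * (INR n + 1) <= Im (w (S n)) * INR n).
  { intros n Hn. destruct (HN1 n Hn) as (A1 & A2 & A3).
    assert (T := sqrt_sqrt (INR n) ltac:(lra)). assert (Hwn := Hw n). unfold inH in Hwn.
    assert (B : (Cmod (w n) + r) ^ 2 <= (c + 1) ^ 2 * INR n).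
    { rewrite <- T. replace ((c + 1) ^ 2 * (sqrt (INR n) * sqrt (INR n))) with (((c + 1) * sqrt (INR n)) ^ 2) by ring.
      apply pow_incr. assert (U := Cmod_ge_0 (w n)). lra. }
    assert (B0 : 0 < (Cmod (w n) + r) ^ 2) by (apply pow_lt; assert (U := Cmod_ge_0 (w n)); lra).
    assert (Hd : 0 <= Im (w (S n)) - Im (w n)).
    { rewrite (Hs n), im_plus. assert (U := Him _ (Hw n)). lra. }
    assert (B2 : (c + 1) ^ 2 * Im (w n) <= (c + 1) ^ 2 * ((Im (w (S n)) - Im (w n)) * INR n)).
    { eapply Rle_trans. apply Hlow.
      eapply Rle_trans. apply Rmult_le_compat_l. exact Hd. exact B. lra. }
    apply Rmult_le_reg_l in B2; [lra|]. apply pow_lt; lra. }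
  set (a := Im (w N1) / INR N1).
  destruct (HN1 N1 (Nat.le_refl _)) as (A1 & _ & _).
  assert (Ha : 0 < a) by (apply Rdiv_lt_0_compat; [apply Hw|lra]).
  assert (Hlin : forall n, (N1 <= n)%nat -> a * INR n <= Im (w n)).
  { intros n Hn. induction Hn as [|n Hn IH]. right; unfold a; field; lra.
    specialize (Hstep n Hn). destruct (HN1 n Hn) as (B1 & _ & _). rewrite S_INR.
    apply (Rmult_le_reg_r (INR n)); [lra|]. nra. }
  apply (sqrt_not_linear a 0 c N1 Ha). intros n Hn. specialize (Hlin n Hn).
  destruct (HN1 n Hn) as (_ & _ & B). assert (T := im_le_Cmod (w n)). lra.
Qed.

(** [pick] along the axis gives |F(i s) - F(i r)| <= K |1/r - 1/s|, so F(i r) has a limit [a], real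
    because Im (F (i r)) <= K / r. Letting r -> oo in [pick] between z and i r yields the estimate,
    which is Julia's inequality Im (-1 / (F - a)) >= Im z / K with denominators cleared. *)
Lemma pick_axis_limit (F : C -> C) (K : R) :
  pick F -> (forall z, inH z -> 0 < Im (F z)) ->
  (forall r, 0 < r -> r * Im (F (0, r)) <= K) ->
  exists a : R, forall z, inH z -> Cmod (F z - a)%C ^ 2 * Im z <= K * Im (F z).
Proof.
  intros Hp Him HK.
  assert (H1 : forall z r, inH z -> 0 < r ->
    Cmod (F z - F (0, r))%C ^ 2 * Im z * r ^ 2 <= K * Im (F z) * Cmod (z - (0, r))%C ^ 2).
  { intros z r Hz Hr. assert (P := Hp z (0, r) Hz (iR_inH r Hr)). specialize (HK r Hr).
    change (Im (0, r)) with r in P. assert (Hz2 := Him z Hz).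
    set (D := Cmod (F z - F (0, r))%C ^ 2) in *. set (E := Cmod (z - (0, r))%C ^ 2) in *.
    assert (HE : 0 <= E) by apply pow2_ge_0.
    apply Rle_trans with ((E * (Im (F z) * Im (F (0, r)))) * r).
    - replace (D * Im z * r ^ 2) with (D * (Im z * r) * r) by ring. apply Rmult_le_compat_r; lra.
    - replace (E * (Im (F z) * Im (F (0, r))) * r) with ((E * Im (F z)) * (r * Im (F (0, r)))) by ring.
      replace (K * Im (F z) * E) with ((E * Im (F z)) * K) by ring.
      apply Rmult_le_compat_l; trivial. nra. }
  assert (HK0 : 0 < K). { specialize (HK 1 Rlt_0_1). specialize (Him (0, 1) (iR_inH 1 Rlt_0_1)). lra. }
  assert (H2 : forall r s, 0 < r -> 0 < s -> Cmod (F (0, s) - F (0, r))%C <= K * Rabs (/ r - / s)).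
  { intros r s Hr Hs. specialize (H1 (0, s) r (iR_inH s Hs) Hr).
    assert (P := HK s Hs). change (Im (0, s)) with s in H1.
    apply Rsqr_incr_0_var; [|apply Rmult_le_pos; [lra|apply Rabs_pos]].
    rewrite Rsqr_mult, <- Rsqr_abs, !Rsqr_pow2.
    replace (Cmod ((0, s) - (0, r))%C ^ 2) with ((s - r) ^ 2) in H1.
    2:{ rewrite Cmod2_alt. unfold Re, Im; simpl; ring. }
    set (D := Cmod (F (0, s) - F (0, r))%C ^ 2) in *.
    assert (Hrs : 0 < s * s * (r * r)) by (repeat apply Rmult_lt_0_compat; trivial).
    apply (Rmult_le_reg_r (s * s * (r * r))); trivial.
    replace (K ^ 2 * (/ r - / s) ^ 2 * (s * s * (r * r))) with (K * K * (s - r) ^ 2) by (field; lra).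
    replace (D * (s * s * (r * r))) with (D * s * r ^ 2 * s) by ring.
    apply Rle_trans with ((K * Im (F (0, s)) * (s - r) ^ 2) * s). apply Rmult_le_compat_r; lra.
    replace (K * Im (F (0, s)) * (s - r) ^ 2 * s) with ((K * (s - r) ^ 2) * (s * Im (F (0, s)))) by ring.
    replace (K * K * (s - r) ^ 2) with ((K * (s - r) ^ 2) * K) by ring.
    apply Rmult_le_compat_l; trivial. apply Rmult_le_pos; [lra|apply pow2_ge_0]. }
  set (u := fun n => Re (F (0, INR n + 1))).
  assert (Hi : forall n, 0 < INR n + 1) by (intros n; assert (T := pos_INR n); lra).
  assert (Hbig : forall e, 0 < e -> exists N, forall n, (N <= n)%nat -> / (INR n + 1) < e).
  { intros e He. destruct (nfloor_ex (/ e)) as [k [_ Hk]]. left; apply Rinv_0_lt_compat; trivial.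
    exists k. intros n Hn. rewrite <- (Rinv_inv e). apply Rinv_lt_contravar.
    apply Rmult_lt_0_compat; [apply Rinv_0_lt_compat|]; trivial.
    apply le_INR in Hn. lra. }
  assert (HC : Cauchy_crit u).
  { intros e He. destruct (Hbig (e / (2 * K))) as [N HN]. apply Rdiv_lt_0_compat; lra.
    exists N. intros n m Hn Hm. assert (B1 := HN n Hn). assert (B2 := HN m Hm).
    unfold Rdist, u.
    replace (Re (F (0, INR n + 1)) - Re (F (0, INR m + 1))) with (Re (F (0, INR n + 1)%R - F (0, INR m + 1)%R)%C)
      by (unfold Re; simpl; ring).
    eapply Rle_lt_trans. apply re_le_Cmod. eapply Rle_lt_trans. apply H2; trivial.
    assert (B3 := Rinv_0_lt_compat _ (Hi n)). assert (B4 := Rinv_0_lt_compat _ (Hi m)).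
    apply Rle_lt_trans with (K * (/ (INR n + 1) + / (INR m + 1))).
    - apply Rmult_le_compat_l. lra. apply Rabs_le_between. lra.
    - replace e with (K * (e / (2 * K) + e / (2 * K))) by (field; lra). apply Rmult_lt_compat_l; lra. }
  destruct (Rcomplete.R_complete u HC) as [a Ha]. exists a. intros z Hz.
  assert (Hzp : 0 < Im z) by exact Hz.
  assert (HFz := Him z Hz).
  assert (L1 : is_lim_seq (fun n => / (INR n + 1)) 0).
  { apply is_lim_seq_spec. intros e. destruct (Hbig e (cond_pos e)) as [N HN]. exists N. intros n Hn.
    rewrite Rminus_0_r, Rabs_pos_eq; [apply HN; trivial|]. left; apply Rinv_0_lt_compat; trivial. }
  assert (L2 : is_lim_seq (fun n => Im (F (0, INR n + 1))) 0).
  { apply (is_lim_seq_le_le (fun _ => 0) _ (fun n => K * / (INR n + 1))).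
    - intros n. split. left; apply Him, iR_inH; trivial.
      apply (proj1 (Rle_div_r _ _ _ (Hi n))). specialize (HK _ (Hi n)). lra.
    - apply is_lim_seq_const.
    - replace (Finite 0) with (Rbar_mult K 0) by (simpl; f_equal; ring). apply (is_lim_seq_scal_l _ K 0). exact L1. }
  apply is_lim_seq_Reals in Ha.
  set (x := Re (F z)) in *. set (y := Im (F z)) in *.
  assert (L3 : is_lim_seq (fun n => ((x - u n) ^ 2 + (y - Im (F (0, INR n + 1))) ^ 2) * Im z)
      (((x - a) ^ 2 + (y - 0) ^ 2) * Im z)).
  { apply is_lim_seq_mult'; [|apply is_lim_seq_const]. apply is_lim_seq_plus'.
    - apply (is_lim_seq_continuous (fun t => (x - t) ^ 2)); [reg|exact Ha].
    - apply (is_lim_seq_continuous (fun t => (y - t) ^ 2)); [reg|exact L2]. }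
  (* The bracket is |z - i r|^2 / r^2 for r = n + 1, written as a polynomial in 1/r; it tends to
     1. *)
  assert (L4 : is_lim_seq (fun n => K * y * ((Re z * / (INR n + 1)) ^ 2 + (Im z * / (INR n + 1) - 1) ^ 2))
     (K * y * ((Re z * 0) ^ 2 + (Im z * 0 - 1) ^ 2))).
  { apply (is_lim_seq_continuous (fun t => K * y * ((Re z * t) ^ 2 + (Im z * t - 1) ^ 2))); [reg|exact L1]. }
  assert (L5 : ((x - a) ^ 2 + (y - 0) ^ 2) * Im z <= K * y * ((Re z * 0) ^ 2 + (Im z * 0 - 1) ^ 2)).
  { refine (is_lim_seq_le _ _ (Finite _) (Finite _) _ L3 L4). intros n.
    specialize (H1 z (INR n + 1) Hz (Hi n)). rewrite !Cmod2_alt in H1.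
    assert (Hn := Hi n).
    apply (Rmult_le_reg_r ((INR n + 1) ^ 2)). apply pow_lt; trivial.
    replace (K * y * ((Re z * / (INR n + 1)) ^ 2 + (Im z * / (INR n + 1) - 1) ^ 2) * (INR n + 1) ^ 2)
      with (K * y * (Re z ^ 2 + (Im z - (INR n + 1)) ^ 2)) by (field; lra).
    eapply Rle_trans; [eapply Rle_trans; [|exact H1]|]; right; unfold u, x, y, Re, Im; simpl; ring. }
  rewrite Cmod2_alt.
  replace (Re (F z - a)%C) with (x - a) by (unfold x, Re; simpl; ring).
  replace (Im (F z - a)%C) with (y - 0) by (unfold y, Im; simpl; ring).
  eapply Rle_trans; [exact L5|]. right; ring.
Qed.

(** * The displacement map and its reciprocal *)

Definition sqrt_bounded (w : nat -> C) : Prop :=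
  exists c N, forall n, (N <= n)%nat -> Cmod (w n) <= c * sqrt (INR n).

Lemma sqrt_bounded_no_drift (w : nat -> C) (a k d : R) : sqrt_bounded w -> 0 < d ->
  ~ (forall n, a * Re (w n) + k * Im (w n) + d <= a * Re (w (S n)) + k * Im (w (S n))).
Proof.
  intros (c & N & Hc) Hd H.
  set (g := fun n => a * Re (w n) + k * Im (w n)).
  assert (Hg : forall n, g 0%nat + d * INR n <= g n).
  { induction n. simpl; lra. rewrite S_INR. specialize (H n). unfold g in *. lra. }
  apply (sqrt_not_linear d (g 0%nat) ((Rabs a + Rabs k) * c) N Hd).
  intros n Hn. specialize (Hg n). specialize (Hc n Hn).
  assert (T1 := re_le_Cmod (w n)). assert (T2 := Rabs_im_le_Cmod (w n)).
  assert (U1 : a * Re (w n) <= Rabs a * Cmod (w n)).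
  { eapply Rle_trans. apply Rle_abs. rewrite Rabs_mult. apply Rmult_le_compat_l; trivial. apply Rabs_pos. }
  assert (U2 : k * Im (w n) <= Rabs k * Cmod (w n)).
  { eapply Rle_trans. apply Rle_abs. rewrite Rabs_mult. apply Rmult_le_compat_l; trivial. apply Rabs_pos. }
  assert (U3 : (Rabs a + Rabs k) * Cmod (w n) <= (Rabs a + Rabs k) * (c * sqrt (INR n))).
  { apply Rmult_le_compat_l; trivial. assert (V1 := Rabs_pos a). assert (V2 := Rabs_pos k). lra. }
  unfold g in *. lra.
Qed.

(** A single real value of [F] annihilates the right side of [pick], so [F] is a real constant a,
    nonzero by hypothesis. Then a Re w grows by a^2 per step, too fast for the square root bound. *)
Lemma displacement_im_pos (F : C -> C) (w : nat -> C) :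
  pick F -> (forall z, inH z -> 0 <= Im (F z)) -> (forall z, inH z -> F z <> 0) ->
  (forall n, inH (w n)) -> (forall n, w (S n) = w n + F (w n))%C -> sqrt_bounded w ->
  forall z, inH z -> 0 < Im (F z).
Proof.
  intros Hp Him Hnz Hw Hs Hb z Hz.
  destruct (Him z Hz) as [H|H]; trivial. exfalso.
  assert (Hconst : forall v, inH v -> F v = F z).
  { intros v Hv. assert (P := Hp v z Hv Hz). rewrite <- H in P. rewrite !Rmult_0_r in P.
    unfold inH in *. apply Ceq_minus, Cmod_eq_0.
    assert (0 < Im v * Im z) by (apply Rmult_lt_0_compat; trivial).
    assert (T := Cmod_ge_0 (F v - F z)%C). apply Rle_antisym; trivial.
    apply Rnot_lt_le. intros Hc. assert (0 < Cmod (F v - F z)%C ^ 2) by (apply pow_lt; trivial). nra. }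
  set (a := Re (F z)).
  assert (Ha : a <> 0).
  { intros E. apply (Hnz z Hz). apply injective_projections; simpl; [exact E|symmetry; exact H]. }
  apply (sqrt_bounded_no_drift w a 0 (a * a) Hb). nra.
  intros n. rewrite (Hs n), re_plus, (Hconst (w n) (Hw n)). fold a. lra.
Qed.

(** z -> -1/z is a hyperbolic isometry: both sides of [pick] get divided by |F z|^2 |F w|^2. *)
Lemma pick_neg_inv (F : C -> C) : pick F -> (forall z, inH z -> 0 < Im (F z)) ->
  pick (fun z => - / F z)%C /\ forall z, inH z ->
    F z <> 0 /\ Im (- / F z)%C = Im (F z) / Cmod (F z) ^ 2 /\ 0 < Im (- / F z)%C.
Proof.
  intros Hp Him.
  assert (Hn : forall z, inH z -> F z <> 0 /\ Im (- / F z)%C = Im (F z) / Cmod (F z) ^ 2 /\ 0 < Im (- / F z)%C).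
  { intros z Hz. specialize (Him z Hz).
    assert (H0 : F z <> 0). { intros E. rewrite E in Him. unfold Im in Him; simpl in Him. lra. }
    assert (Hm : 0 < Cmod (F z) ^ 2) by (apply pow_lt, Cmod_gt_0; trivial).
    assert (E : Im (- / F z)%C = Im (F z) / Cmod (F z) ^ 2).
    { rewrite Cmod2_alt in *. unfold Re, Im in *; simpl in *. field. lra. }
    repeat split; trivial. rewrite E. apply Rdiv_lt_0_compat; trivial. }
  split; trivial.
  intros z w Hz Hw. destruct (Hn z Hz) as (z1 & z2 & _). destruct (Hn w Hw) as (w1 & w2 & _).
  rewrite z2, w2.
  replace (- / F z - - / F w)%C with ((F z - F w) / (F z * F w))%C by (field; split; trivial).
  rewrite Cmod_div, Cmod_mult by (apply Cmult_neq_0; trivial).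
  apply Cmod_gt_0 in z1. apply Cmod_gt_0 in w1.
  assert (P := Hp z w Hz Hw).
  assert (Q : 0 < Cmod (F z) ^ 2 * Cmod (F w) ^ 2) by (apply Rmult_lt_0_compat; apply pow_lt; trivial).
  apply (Rmult_le_reg_r (Cmod (F z) ^ 2 * Cmod (F w) ^ 2)); trivial.
  eapply Rle_trans; [eapply Rle_trans; [|exact P]|]; right; field; lra.
Qed.

(** Positivity of the angular derivative of -1/F at infinity. If it vanished, -1/F would be o(z) on
    the axis; the limit [a] of [F] along the axis would then be nonzero, and the orbit would
    drift. *)
Lemma displacement_inv_coercive (F : C -> C) (w : nat -> C) :
  pick F -> (forall z, inH z -> 0 < Im (F z)) ->
  (forall n, inH (w n)) -> (forall n, w (S n) = w n + F (w n))%C -> sqrt_bounded w ->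
  exists b, 0 < b /\ forall z, inH z -> b * Im z <= Im (- / F z)%C.
Proof.
  intros Hp Him Hw Hs Hb.
  apply NNPP. intros Hno.
  destruct (pick_neg_inv F Hp Him) as [Hq Hn].
  assert (Hinf : forall e, 0 < e -> exists z, inH z /\ Im (- / F z)%C <= e * Im z).
  { intros e He. apply NNPP. intros Hc. apply Hno. exists e. split; trivial.
    intros z Hz. apply Rnot_lt_le. intros Hl. apply Hc. exists z. split; trivial. lra. }
  destruct Hb as (c & N & Hc).
  destruct (orbit_sqrt_bound F w c N Hp Him Hw Hs Hc) as (K & HK0 & HK).
  destruct (pick_axis_limit F K Hp Him HK) as (a & Ha).
  (* If a = 0, the axis estimate gives (T |F(i T)|)^2 <= K (T Im F(i T)) <= K^2, whereas
     sublinearity of -1/F with constant 1/(2K) gives T |F(i T)| >= 2K. *)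
  assert (Ha0 : a <> 0).
  { intros E. subst a.
    destruct (pick_sublinear _ Hq) with (M := 1) (e := / (2 * K)) as (T & HT & HTz); trivial; try lra.
    { intros z Hz. left. apply Hn; trivial. }
    { apply Rinv_0_lt_compat; lra. }
    assert (HiT := iR_inH T HT).
    specialize (HTz (0, T) HiT). rewrite Cmod_iR in HTz by lra.
    change (Im (0, T)) with T in HTz. specialize (HTz ltac:(lra) ltac:(lra)).
    destruct (Hn _ HiT) as (F0 & _ & _). rewrite Cmod_opp, Cmod_inv in HTz by trivial.
    apply Cmod_gt_0 in F0. specialize (Ha _ HiT). specialize (HK T HT).
    change (Im (0, T)) with T in Ha. replace (F (0, T) - 0)%C with (F (0, T)) in Ha by ring.
    set (m := Cmod (F (0, T))) in *.
    assert (E1 : 2 * K <= T * m).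
    { apply (Rmult_le_compat_r (2 * K * m)) in HTz; [|nra].
      replace (/ m * (2 * K * m)) with (2 * K) in HTz by (field; lra).
      replace (/ (2 * K) * T * (2 * K * m)) with (T * m) in HTz by (field; lra). exact HTz. }
    assert (E2 : (T * m) ^ 2 <= K * K).
    { replace ((T * m) ^ 2) with (m ^ 2 * T * T) by ring.
      apply Rle_trans with (K * Im (F (0, T)) * T). apply Rmult_le_compat_r; lra.
      rewrite Rmult_assoc. apply Rmult_le_compat_l; lra. }
    nra. }
  set (y0 := Im (w 0%nat)). assert (Hy0 : 0 < y0) by apply (Hw 0%nat).
  assert (Hmono : forall n, y0 <= Im (w n)).
  { induction n. unfold y0; lra. rewrite Hs, im_plus. assert (T := Him _ (Hw n)). lra. }
  (* With F(w n) = x + i y, the height term is at least (x - a)^2 / 2, and a x + (x - a)^2 / 2 =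
     (x^2 + a^2) / 2 >= a^2 / 2. *)
  apply (sqrt_bounded_no_drift w a (K / (2 * y0)) (a * a / 2)). exists c, N; trivial. nra.
  intros n. rewrite (Hs n), re_plus, im_plus.
  specialize (Ha _ (Hw n)). rewrite Cmod2_alt in Ha.
  replace (Re (F (w n) - a)%C) with (Re (F (w n)) - a) in Ha by (unfold Re; simpl; ring).
  set (x := Re (F (w n))) in *. set (y := Im (F (w n))) in *.
  assert (H1 : (x - a) ^ 2 * y0 <= K * y).
  { eapply Rle_trans; [|exact Ha].
    apply Rle_trans with ((x - a) ^ 2 * Im (w n)).
    apply Rmult_le_compat_l. apply pow2_ge_0. apply Hmono.
    apply Rmult_le_compat_r. specialize (Hmono n). lra.
    assert (T := pow2_ge_0 (Im (F (w n) - a)%C)). lra. }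
  assert (H2 : (x - a) ^ 2 / 2 <= K / (2 * y0) * y).
  { apply (Rmult_le_reg_r (2 * y0)); [lra|].
    replace (K / (2 * y0) * y * (2 * y0)) with (K * y) by (field; lra). lra. }
  nra.
Qed.

(** In the variable z^2, [f] is asymptotically the translation by -2c, uniformly in each Stolz angle
    |z| <= M Im z. *)
Definition nontangential_step (f : C -> C) (c : R) : Prop :=
  forall M e, 0 < M -> 0 < e -> exists T, 0 < T /\
    forall z, inH z -> Cmod z <= M * Im z -> T <= Cmod z ->
      Cmod (f z ^ 2 - z ^ 2 + 2 * c)%C <= e.

(* [1/c] is the angular derivative of [-1 / (f(z) - z)] at infinity. *)
Lemma square_step (f : C -> C) (w : nat -> C) :
  (forall z, inH z -> ex_cderive f z) ->
  (forall z, inH z -> Im z <= Im (f z)) -> (forall z, inH z -> f z <> z) ->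
  (forall n, inH (w n)) -> (forall n, w (S n) = f (w n)) -> sqrt_bounded w ->
  exists c, 0 < c /\ nontangential_step f c.
Proof.
  intros Hd Hj Hfix Hw Hs Hb.
  set (F := fun z : C => (f z - z)%C).
  assert (HFd : forall z, inH z -> ex_cderive F z).
  { intros z Hz. apply ex_cderive_minus; [apply Hd; trivial|apply ex_cderive_id]. }
  assert (HF0 : forall z, inH z -> 0 <= Im (F z)).
  { intros z Hz. specialize (Hj z Hz). unfold F. unfold Im in *; simpl. lra. }
  assert (HFp : pick F) by (intros z v Hz Hv; apply schwarz_pick_closed; trivial).
  assert (HFs : forall n, w (S n) = (w n + F (w n))%C) by (intros n; rewrite Hs; unfold F; ring).
  assert (HFi : forall z, inH z -> 0 < Im (F z)).
  { apply (displacement_im_pos F w); trivial. intros z Hz E. apply (Hfix z Hz), Ceq_minus; trivial. }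
  destruct (displacement_inv_coercive F w HFp HFi Hw HFs Hb) as (b0 & Hb0 & Hcoer).
  destruct (pick_neg_inv F HFp HFi) as [_ Hn].
  (* The infimum of Im (-1/F) / Im z, taken as the largest admissible constant and bounded by the
     value at i. Its maximality is what makes Im p / Im z arbitrarily small below. *)
  destruct (completeness (fun b => forall z, inH z -> b * Im z <= Im (- / F z)%C)) as [b [Hb1 Hb2]].
  { exists (Im (- / F Ci)%C). intros v Hv. specialize (Hv Ci). change (Im Ci) with 1 in Hv.
    rewrite Rmult_1_r in Hv. apply Hv. apply Rlt_0_1. }
  { exists b0. trivial. }
  assert (Hbp : 0 < b) by (apply Rlt_le_trans with b0; trivial; apply Hb1; trivial).
  assert (Hbc : forall z, inH z -> b * Im z <= Im (- / F z)%C).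
  { intros z Hz. assert (Hzp : 0 < Im z) by exact Hz.
    apply (proj2 (Rle_div_r _ _ _ Hzp)). apply Hb2. intros v Hv.
    apply (proj1 (Rle_div_r _ _ _ Hzp)). apply Hv; trivial. }
  set (p := fun z => (- / F z - RtoC b * z)%C).
  assert (Hpi : forall z, Im (p z) = Im (- / F z)%C - b * Im z) by (intros z; unfold p, Im; simpl; ring).
  assert (Hp0 : forall z, inH z -> 0 <= Im (p z)).
  { intros z Hz. rewrite Hpi. specialize (Hbc z Hz). lra. }
  assert (Hpp : pick p).
  { intros z v Hz Hv. apply schwarz_pick_closed; trivial. intros u Hu. unfold p.
    apply ex_cderive_minus.
    - assert (E : ex_cderive (fun z => (RtoC (-1) * / F z)%C) u).
      { apply ex_cderive_mult; [apply ex_cderive_const|]. apply ex_cderive_inv; [apply Hn; trivial|apply HFd; trivial]. }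
      eapply ex_derive_ext; [|exact E]. intros t. simpl. ring.
    - apply ex_cderive_mult; [apply ex_cderive_const|apply ex_cderive_id]. }
  assert (Hinf : forall e, 0 < e -> exists z, inH z /\ Im (p z) <= e * Im z).
  { intros e He. apply NNPP. intros Hc.
    assert (b + e <= b); [|lra]. apply Hb1. intros z Hz. apply Rnot_lt_le. intros Hl.
    apply Hc. exists z. split; trivial. rewrite Hpi. lra. }
  exists (/ b). split. apply Rinv_0_lt_compat; trivial.
  intros M e HM He.
  (* The bound b/2 gives |b z + p| >= b |z| / 2, hence |F| <= 2 / (b |z|); the bound e b^2 / 8 then
     makes 2 |p F| / b at most e/2. The other half of [e] pays for F^2. *)
  set (e' := Rmin (b / 2) (e * b ^ 2 / 8)).
  assert (Hb2' : 0 < b ^ 2) by (apply pow_lt; trivial).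
  assert (He' : 0 < e') by (apply Rmin_pos; nra).
  assert (He1 : e' <= b / 2) by apply Rmin_l. assert (He2 : e' <= e * b ^ 2 / 8) by apply Rmin_r.
  destruct (pick_sublinear p Hpp Hp0 Hinf M e' HM He') as (T & HT & HTz).
  assert (HX : 0 < 8 / (b ^ 2 * e)) by (apply Rdiv_lt_0_compat; nra).
  exists (T + 1 + 8 / (b ^ 2 * e)). split. lra.
  intros z Hz HzM HzT. specialize (HTz z Hz HzM ltac:(lra)).
  destruct (Hn z Hz) as (F0 & _ & _).
  set (r := Cmod z) in *.
  assert (Hz0 : z <> 0) by (apply Cmod_gt_0; fold r; lra).
  assert (Hbz : b / 2 * r <= Cmod (- / F z)%C).
  { replace (- / F z)%C with (RtoC b * z - (- p z))%C by (unfold p; ring).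
    eapply Rle_trans; [|apply Cmod_minus_ge]. rewrite Cmod_opp, Cmod_mult, Cmod_R, Rabs_pos_eq by lra.
    fold r. nra. }
  assert (HFm : Cmod (F z) * (b * r) <= 2).
  { assert (Q := proj1 (Cmod_gt_0 _) F0). rewrite Cmod_opp, Cmod_inv in Hbz by trivial.
    apply (Rmult_le_compat_r (Cmod (F z))) in Hbz; [|lra]. rewrite Rinv_l in Hbz by lra. lra. }
  assert (Hbn : RtoC b <> 0) by (intros E; apply RtoC_inj in E; lra).
  (* From -1/F = b z + p one gets z F = - (1 + p F) / b, inserted into f^2 - z^2 = 2 z F + F^2. *)
  replace (f z ^ 2 - z ^ 2 + 2 * RtoC (/ b))%C with (2 * (p z * F z * RtoC (- / b)) + F z * F z)%C.
  2:{ rewrite RtoC_opp, RtoC_inv by lra. replace (f z) with (z + F z)%C by (unfold F; ring).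
      unfold p. field. split; trivial. }
  assert (Hr1 : 1 <= r) by lra.
  assert (Fm0 := Cmod_ge_0 (F z)).
  eapply Rle_trans. apply Cmod_triangle. rewrite !Cmod_mult, !Cmod_R, Rabs_Ropp.
  rewrite (Rabs_pos_eq 2), (Rabs_pos_eq (/ b)) by (try lra; left; apply Rinv_0_lt_compat; trivial).
  assert (G1 : Cmod (p z) * Cmod (F z) * b ^ 2 <= e / 4 * b ^ 2 * b).
  { apply Rle_trans with (e' * (Cmod (F z) * (b * r)) * b).
    - apply Rle_trans with (e' * r * Cmod (F z) * b ^ 2); [|right; ring].
      apply Rmult_le_compat_r; [lra|]. apply Rmult_le_compat_r; lra.
    - apply Rmult_le_compat_r; [lra|]. nra. }
  assert (G2 : Cmod (F z) * Cmod (F z) <= e / 2).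
  { assert (Hr2 : 8 <= b ^ 2 * e * r).
    { assert (8 / (b ^ 2 * e) <= r) by lra. apply (Rle_div_l 8 r (b ^ 2 * e)) in H; [lra|nra]. }
    assert (Q : (Cmod (F z) * (b * r)) * (Cmod (F z) * (b * r)) <= 2 * 2).
    { apply Rmult_le_compat; trivial; apply Rmult_le_pos; try lra; nra. }
    assert (Q2 : Cmod (F z) * Cmod (F z) * (b ^ 2 * r) <= 4).
    { eapply Rle_trans; [|eapply Rle_trans; [exact Q|lra]].
      replace (Cmod (F z) * (b * r) * (Cmod (F z) * (b * r))) with (Cmod (F z) * Cmod (F z) * (b ^ 2 * r) * r) by ring.
      rewrite <- (Rmult_1_r (Cmod (F z) * Cmod (F z) * (b ^ 2 * r))) at 1.
      apply Rmult_le_compat_l; trivial. apply Rmult_le_pos; nra. }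
    apply (Rmult_le_reg_r (b ^ 2 * r)). nra. nra. }
  assert (G3 : Cmod (p z) * Cmod (F z) * / b <= e / 4).
  { apply (Rmult_le_reg_r (b ^ 2 * b)). nra.
    replace (Cmod (p z) * Cmod (F z) * / b * (b ^ 2 * b)) with (Cmod (p z) * Cmod (F z) * b ^ 2) by (field; lra).
    lra. }
  lra.
Qed.

(** * Asymptotics of discrete orbits *)

(** Points at bounded hyperbolic distance have comparable heights: drop the real part, expand (Im v
    - Im u)^2 and divide by Im u. *)
Lemma close_points_comparable (u v : C) (K : R) : 0 <= K -> inH u -> inH v ->
  Cmod (v - u)%C ^ 2 <= K * (Im v * Im u) ->
  Im u <= (K + 2) * Im v /\ Cmod (v - u)%C ^ 2 <= K * (K + 2) * Im v ^ 2.
Proof.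
  unfold inH; intros HK Hu Hv H.
  assert (H1 : Im u <= (K + 2) * Im v).
  { assert (T := H). rewrite Cmod2_alt in T.
    replace (Im (v - u)%C) with (Im v - Im u) in T by (unfold Im; simpl; ring).
    assert (T2 := pow2_ge_0 (Re (v - u)%C)).
    apply (Rmult_le_reg_r (Im u)); trivial. nra. }
  split; trivial. eapply Rle_trans. exact H. nra.
Qed.

(* The sets [Re z^2 <= - T^2] are invariant and nontangential, so orbits starting far up the
   imaginary axis are controlled. *)
Lemma axis_orbit (f : C -> C) (c : R) :
  (forall z, inH z -> inH (f z)) -> 0 < c -> nontangential_step f c ->
  exists z, inH z /\ forall n, let u := Nat.iter n f z in
    inH u /\ Cmod u <= 2 * Im u /\ c * INR n <= Im u ^ 2.
Proof.
  intros Hf Hc Hstep.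
  (* With error c against the translation -2c, each step lowers Re (u^2) by at least c. The opening
     2 suffices, since Re (u^2) <= 0 means |u|^2 <= 2 (Im u)^2. *)
  destruct (Hstep 2 c ltac:(lra) Hc) as (T & HT & HTz).
  exists (0, T). split. exact HT.
  assert (H : forall n, let u := Nat.iter n f (0, T) in inH u /\ Re u ^ 2 - Im u ^ 2 <= - T ^ 2 - c * INR n).
  { induction n as [|n IH].
    - simpl. split. exact HT. lra.
    - destruct IH as [I1 I2]. set (u := Nat.iter n f (0, T)) in *.
      change (Nat.iter (S n) f (0, T)) with (f u). split. apply Hf; trivial.
      assert (N0 : 0 <= c * INR n) by (apply Rmult_le_pos; [lra|apply pos_INR]).
      unfold inH in I1.
      assert (S1 : Cmod u <= 2 * Im u).
      { apply Rsqr_incr_0_var; [|lra]. rewrite !Rsqr_pow2, Cmod2_alt. nra. }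
      assert (S2 : T <= Cmod u).
      { apply Rsqr_incr_0_var; [|apply Cmod_ge_0]. rewrite !Rsqr_pow2, Cmod2_alt.
        assert (T2 := pow2_ge_0 (Re u)). nra. }
      specialize (HTz u I1 S1 S2).
      assert (R1 := re_le_Cmod (f u ^ 2 - u ^ 2 + 2 * c)%C). apply Rabs_le_between in R1.
      replace (Re (f u ^ 2 - u ^ 2 + 2 * c)%C) with ((Re (f u) ^ 2 - Im (f u) ^ 2) - (Re u ^ 2 - Im u ^ 2) + 2 * c) in R1
        by (unfold Re, Im; simpl; ring).
      rewrite S_INR. lra. }
  intros n u. destruct (H n) as [I1 I2]. fold u in I1, I2. unfold inH in *.
  assert (N0 : 0 <= c * INR n) by (apply Rmult_le_pos; [lra|apply pos_INR]).
  assert (T2 := pow2_ge_0 (Re u)). assert (T3 := pow2_ge_0 T).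
  repeat split; trivial; [|lra].
  apply Rsqr_incr_0_var; [|lra]. rewrite !Rsqr_pow2, Cmod2_alt. nra.
Qed.

(** By [pick] the invariant [K] between the orbit of z and that of the axis point never grows, so
    the orbit of z inherits a Stolz angle, of larger opening, and the escape to infinity. *)
Lemma orbit_nontangential (f : C -> C) (c : R) (z : C) :
  (forall z, inH z -> inH (f z)) -> pick f -> 0 < c -> nontangential_step f c -> inH z ->
  exists M, 0 < M /\ (forall n, Cmod (Nat.iter n f z) <= M * Im (Nat.iter n f z)) /\
    forall T, exists N, forall n, (N <= n)%nat -> T <= Cmod (Nat.iter n f z).
Proof.
  intros Hf Hp Hc Hstep Hz.
  destruct (axis_orbit f c Hf Hc Hstep) as (z1 & Hz1 & Hu).
  assert (Hz' : 0 < Im z) by exact Hz. assert (Hz1' : 0 < Im z1) by exact Hz1.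
  set (K := Cmod (z - z1)%C ^ 2 / (Im z * Im z1)).
  assert (HK : 0 <= K) by (apply Rle_div_r; [nra|rewrite Rmult_0_l; apply pow2_ge_0]).
  assert (H : forall n, inH (Nat.iter n f z) /\ Cmod (Nat.iter n f z - Nat.iter n f z1)%C ^ 2
     <= K * (Im (Nat.iter n f z) * Im (Nat.iter n f z1))).
  { induction n as [|n [I1 I2]].
    - split; trivial. simpl Nat.iter. right; unfold K. field. lra.
    - simpl Nat.iter. set (v := Nat.iter n f z) in *. destruct (Hu n) as (J1 & _). set (u := Nat.iter n f z1) in *.
      split. apply Hf; trivial. assert (P := Hp v u I1 J1).
      assert (J2 := Hf u J1). assert (I3 := Hf v I1). unfold inH in *.
      assert (Q : 0 < Im v * Im u) by (apply Rmult_lt_0_compat; trivial).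
      apply (Rmult_le_reg_r (Im v * Im u)); trivial. eapply Rle_trans. exact P.
      replace (K * (Im (f v) * Im (f u)) * (Im v * Im u)) with (K * (Im v * Im u) * (Im (f v) * Im (f u))) by ring.
      apply Rmult_le_compat_r; trivial. nra. }
  assert (H2 : forall n, Im (Nat.iter n f z1) <= (K + 2) * Im (Nat.iter n f z) /\
     Cmod (Nat.iter n f z) <= 3 * (K + 2) * Im (Nat.iter n f z)).
  { intros n. destruct (H n) as [I1 I2]. destruct (Hu n) as (J1 & J2 & _).
    set (v := Nat.iter n f z) in *. set (u := Nat.iter n f z1) in *.
    destruct (close_points_comparable u v K HK J1 I1 I2) as [L1 L2]. split; trivial.
    unfold inH in *.
    assert (L3 : Cmod (v - u)%C <= (K + 2) * Im v).
    { apply Rsqr_incr_0_var; [|nra]. rewrite !Rsqr_pow2. eapply Rle_trans. exact L2. 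
      assert (0 <= Im v ^ 2) by apply pow2_ge_0. nra. }
    replace v with ((v - u) + u)%C at 1 by ring. eapply Rle_trans. apply Cmod_triangle. lra. }
  exists (3 * (K + 2)). split. lra. split. intros n; apply H2.
  intros T.
  destruct (nfloor_ex (((K + 2) * Rabs T) ^ 2 / c)) as [N [_ HN]].
  { apply Rle_div_r; [lra|]. rewrite Rmult_0_l. apply pow2_ge_0. }
  exists (S N). intros n Hn. apply le_INR in Hn. rewrite S_INR in Hn.
  destruct (Hu n) as (J1 & _ & J3). destruct (H2 n) as (L1 & _). unfold inH in J1.
  eapply Rle_trans; [|apply im_le_Cmod].
  apply Rle_trans with (Rabs T). apply Rle_abs.
  apply (Rmult_le_reg_l (K + 2)); [lra|]. eapply Rle_trans; [|exact L1].
  apply Rsqr_incr_0_var; [|lra]. rewrite !Rsqr_pow2. eapply Rle_trans; [|exact J3].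
  assert (E : ((K + 2) * Rabs T) ^ 2 = c * (((K + 2) * Rabs T) ^ 2 / c)) by (field; lra).
  rewrite E. apply Rmult_le_compat_l; lra.
Qed.

(** The errors telescope: from some index on each step adds at most e/2, and the error accumulated
    up to that index is eventually below (e/2) n. *)
Lemma square_asymptotics (f : C -> C) (c : R) (z : C) :
  (forall z, inH z -> inH (f z)) -> pick f -> 0 < c -> nontangential_step f c -> inH z ->
  forall e, 0 < e -> exists N, forall n, (N <= n)%nat ->
    Cmod (Nat.iter n f z ^ 2 + 2 * c * INR n)%C <= e * INR n.
Proof.
  intros Hf Hp Hc Hstep Hz e He.
  assert (Hit : forall n, inH (Nat.iter n f z)).
  { induction n; trivial. apply Hf; trivial. }
  destruct (orbit_nontangential f c z Hf Hp Hc Hstep Hz) as (M & HM & HM1 & HM2).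
  destruct (Hstep M (e / 2) HM ltac:(lra)) as (T & HT & HTz).
  destruct (HM2 T) as [N HN].
  set (a := fun n => (Nat.iter n f z ^ 2 + 2 * c * INR n)%C).
  assert (Ha : forall n, (N <= n)%nat -> Cmod (a n) <= Cmod (a N) + e / 2 * INR n).
  { intros n Hn. induction Hn as [|n Hn IH].
    - assert (U := pos_INR N). nra.
    - rewrite S_INR.
      replace (a (S n)) with ((f (Nat.iter n f z) ^ 2 - Nat.iter n f z ^ 2 + 2 * c) + a n)%C.
      2:{ unfold a. rewrite S_INR, RtoC_plus. simpl Nat.iter. ring. }
      eapply Rle_trans. apply Cmod_triangle. specialize (HTz _ (Hit n) (HM1 n) (HN n Hn)). lra. }
  destruct (nfloor_ex (2 * Cmod (a N) / e)) as [k [_ Hk]].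
  { apply Rle_div_r; [lra|]. assert (U := Cmod_ge_0 (a N)). lra. }
  exists (max N (S k)). intros n Hn. change (Cmod (a n) <= e * INR n).
  specialize (Ha n ltac:(lia)).
  assert (Hn2 : 2 * Cmod (a N) / e <= INR n).
  { apply Rle_trans with (INR (S k)). rewrite S_INR; lra. apply le_INR; lia. }
  apply (proj1 (Rle_div_l _ _ _ He)) in Hn2. lra.
Qed.

(** * Continuous time *)

Lemma semigroup_pick (phi : R -> C -> C) t : semigroupH phi -> 0 <= t -> pick (phi t).
Proof.
  intros (H1 & H2 & _) Ht z w Hz Hw. apply schwarz_pick; trivial.
  - intros v Hv. apply holomorphic_ex_cderive, H1; trivial.
  - intros v Hv. apply H2; trivial.
Qed.

Lemma semigroup_iter (phi : R -> C -> C) h n z : semigroupH phi -> 0 <= h -> inH z ->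
  Nat.iter n (phi h) z = phi (INR n * h) z.
Proof.
  intros (_ & H2 & H3 & H4 & _) Hh Hz. induction n as [|n IH].
  - simpl. rewrite Rmult_0_l, H3; trivial.
  - simpl Nat.iter. rewrite IH, <- H4; trivial. f_equal. rewrite S_INR; ring.
    apply Rmult_le_pos; trivial. apply pos_INR.
Qed.

Lemma INR_eventually (x : R) : exists N, forall n, (N <= n)%nat -> x <= INR n.
Proof.
  destruct (nfloor_ex (Rabs x)) as [k [_ Hk]]. apply Rabs_pos.
  exists (S k). intros n Hn. apply le_INR in Hn. rewrite S_INR in Hn. assert (T := Rle_abs x). lra.
Qed.

Lemma semigroup_julia (phi : R -> C -> C) t z : semigroupH phi -> DW_infty phi -> 0 <= t -> inH z ->
  Im z <= Im (phi t z).
Proof.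
  intros Hs HD [Ht|<-] Hz.
  2:{ destruct Hs as (_ & _ & H3 & _). rewrite H3; trivial. lra. }
  assert (Hi : inH Ci) by apply Rlt_0_1.
  assert (H2 := proj1 (proj2 Hs)).
  apply (julia (phi t) (fun n => Nat.iter n (phi t) Ci)); trivial.
  - apply semigroup_pick; trivial; lra.
  - induction n; trivial. apply H2; trivial; lra.
  - intros M. assert (L := HD Ci Hi). apply is_lim_spec in L. destruct (L M) as [T HT].
    destruct (INR_eventually ((T + 1) / t)) as [N HN]. exists N. intros n Hn. specialize (HN n Hn).
    apply (proj1 (Rle_div_l _ _ _ Ht)) in HN.
    rewrite semigroup_iter by (trivial; lra). left. apply HT. lra.
  - apply H2; trivial; lra.
Qed.

Definition sqrt_bounded_orbit (phi : R -> C -> C) : Prop :=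
  exists z c T, inH z /\ forall t, T < t -> Cmod (phi t z) <= c * sqrt t.

Lemma discrete_asymptotics (phi : R -> C -> C) (h : R) :
  semigroupH phi -> non_ellipticH phi -> DW_infty phi -> sqrt_bounded_orbit phi -> 0 < h ->
  exists c, 0 < c /\ forall z e, inH z -> 0 < e -> exists N, forall n, (N <= n)%nat ->
    Cmod (phi (INR n * h)%R z ^ 2 + 2 * c * INR n)%C <= e * INR n.
Proof.
  intros Hs Hne HD (z0 & c & T & Hz0 & HT) Hh.
  assert (A1 := proj1 Hs). assert (A2 := proj1 (proj2 Hs)).
  assert (Hsb : sqrt_bounded (fun n => Nat.iter n (phi h) z0)).
  { destruct (INR_eventually ((T + 1) / h)) as [N HN].
    exists (c * sqrt h), N. intros n Hn. specialize (HN n Hn). apply (proj1 (Rle_div_l _ _ _ Hh)) in HN.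
    rewrite semigroup_iter by (trivial; lra).
    eapply Rle_trans. apply HT. lra. right. rewrite sqrt_mult; [ring|apply pos_INR|lra]. }
  destruct (square_step (phi h) (fun n => Nat.iter n (phi h) z0)) as (c1 & Hc1 & Hstep); trivial.
  - intros z Hz. apply holomorphic_ex_cderive, A1; trivial; lra.
  - intros z Hz. apply semigroup_julia; trivial; lra.
  - intros z Hz. apply Hne; trivial.
  - induction n; trivial. apply A2; trivial; lra.
  - exists c1. split; trivial. intros z e Hz He.
    destruct (square_asymptotics (phi h) c1 z) with (e := e) as [N HN]; trivial.
    + intros; apply A2; trivial; lra.
    + apply semigroup_pick; trivial; lra.
    + exists N. intros n Hn. rewrite <- semigroup_iter by (trivial; lra). apply HN; trivial.
Qed.

(** Each step h has its own constant. The lattices of steps 1 and 1/k share the integer times, index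
    n in one being n k in the other, so the constants differ exactly by the factor k and a single
    [c] per unit of time serves all of them. *)
Lemma lattice_asymptotics (phi : R -> C -> C) :
  semigroupH phi -> non_ellipticH phi -> DW_infty phi -> sqrt_bounded_orbit phi ->
  exists c, 0 < c /\ forall m z e, inH z -> 0 < e -> exists N, forall n, (N <= n)%nat ->
    let t := INR n * / INR (S m) in Cmod (phi t z ^ 2 + 2 * c * t)%C <= e * t.
Proof.
  intros Hs Hne HD Hb.
  destruct (discrete_asymptotics phi 1 Hs Hne HD Hb Rlt_0_1) as (c & Hc & H1).
  exists c. split; trivial. intros m.
  set (k := INR (S m)). assert (Hk : 0 < k) by apply lt_0_INR, Nat.lt_0_succ.
  destruct (discrete_asymptotics phi (/ k) Hs Hne HD Hb (Rinv_0_lt_compat _ Hk)) as (c' & Hc' & H2).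
  assert (E : c' * k = c).
  { apply Rminus_diag_uniq, Rabs_eq_0, Rle_antisym; [|apply Rabs_pos]. apply le_epsilon. intros e He.
    rewrite Rplus_0_l.
    assert (Hi : inH Ci) by apply Rlt_0_1.
    destruct (H1 Ci e Hi He) as [N1 HN1].
    destruct (H2 Ci (e / k) Hi) as [N2 HN2]. apply Rdiv_lt_0_compat; trivial.
    set (n := max 1 (max N1 N2)). specialize (HN1 n ltac:(lia)). specialize (HN2 (n * S m)%nat ltac:(lia)).
    rewrite mult_INR in HN2. fold k in HN2. replace (INR n * k * / k) with (INR n * 1) in HN2 by (field; lra).
    assert (Hn : 1 <= INR n) by (change 1 with (INR 1); apply le_INR; lia).
    set (a := phi (INR n * 1) Ci) in *.
    replace (e / k * (INR n * k)) with (e * INR n) in HN2 by (field; lra).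
    assert (T := Cmod_minus_le (a ^ 2 + 2 * c' * (INR n * k)%R) (a ^ 2 + 2 * c * INR n)).
    replace (a ^ 2 + 2 * c' * (INR n * k)%R - (a ^ 2 + 2 * c * INR n))%C with (RtoC (2 * (c' * k - c) * INR n)) in T
      by (rewrite !RtoC_mult, RtoC_minus, RtoC_mult; ring).
    rewrite Cmod_R, !Rabs_mult, (Rabs_pos_eq 2), (Rabs_pos_eq (INR n)) in T by lra.
    apply (Rmult_le_reg_r (INR n)); lra. }
  intros z e Hz He. destruct (H2 z (e / k) Hz) as [N HN]. apply Rdiv_lt_0_compat; trivial.
  exists N. intros n Hn. specialize (HN n Hn). cbv zeta.
  replace (2 * c * (INR n * / k)%R)%C with (2 * c' * INR n)%C.
  2:{ rewrite <- E, <- !RtoC_mult. f_equal. field. lra. }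
  eapply Rle_trans. exact HN. right; field; lra.
Qed.

(** Factor w^2 + l^2 t = (w - i l sqrt t) (w + i l sqrt t); in the half-plane the second factor is
    at least l sqrt t, which selects the root. *)
Lemma sqrt_of_square (w : C) (l t e : R) : 0 < l -> 0 < t -> inH w ->
  Cmod (w ^ 2 + (l ^ 2 * t)%R)%C <= e * t -> Cmod (w - Ci * (l * sqrt t)%R)%C <= e / l * sqrt t.
Proof.
  intros Hl Ht Hw H. unfold inH in Hw.
  assert (Hst : 0 < sqrt t) by (apply sqrt_lt_R0; trivial).
  assert (Hss := sqrt_sqrt t ltac:(lra)). set (s := sqrt t) in *.
  replace (w ^ 2 + (l ^ 2 * t)%R)%C with ((w - Ci * (l * s)%R) * (w + Ci * (l * s)%R))%C in H.
  2:{ rewrite <- Hss. apply injective_projections; simpl; ring. }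
  rewrite Cmod_mult in H.
  assert (Hp : l * s <= Cmod (w + Ci * (l * s)%R)%C).
  { eapply Rle_trans; [|apply im_le_Cmod]. unfold Im in *; simpl. lra. }
  assert (N := Cmod_ge_0 (w - Ci * (l * s)%R)%C).
  assert (Hls : 0 < l * s) by (apply Rmult_lt_0_compat; trivial).
  apply (Rmult_le_reg_r (l * s)); trivial.
  replace (e / l * s * (l * s)) with (e * (s * s)) by (field; lra). rewrite Hss.
  eapply Rle_trans; [|exact H]. apply Rmult_le_compat_l; trivial.
Qed.

Lemma right_continuity (phi : R -> C -> C) z e : semigroupH phi -> inH z -> 0 < e ->
  exists d, 0 < d /\ forall s, 0 <= s < d -> Cmod (phi s z - z)%C <= e.
Proof.
  intros (_ & _ & H3 & _ & H5) Hz He.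
  assert (He2 : 0 < e / 2) by lra.
  destruct (H5 z Hz (fun v => Cmod (v - z)%C <= e)) as [d Hd].
  { exists (mkposreal _ He2). intros v [B1 B2]. 
    eapply Rle_trans. apply Cmod_2Rmax.
    assert (S2 : sqrt 2 <= 2). { rewrite <- (sqrt_square 2) at 2 by lra. apply sqrt_le_1_alt. lra. }
    assert (S0 := sqrt_pos 2).
    assert (M : Rmax (Rabs (fst (v - z)%C)) (Rabs (snd (v - z)%C)) <= e / 2) by (apply Rmax_lub; left; assumption).
    assert (M0 : 0 <= Rmax (Rabs (fst (v - z)%C)) (Rabs (snd (v - z)%C))) by (eapply Rle_trans; [apply Rabs_pos|apply Rmax_l]).
    nra. }
  exists d. split. apply cond_pos. intros s [[Hs|<-] Hs2].
  - apply Hd; trivial. change (Rabs (s - 0) < d). rewrite Rminus_0_r, Rabs_pos_eq; lra.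
  - rewrite H3 by trivial. replace (z - z)%C with (RtoC 0) by ring. rewrite Cmod_0; lra.
Qed.

Definition sqrt_asymptotic (phi : R -> C -> C) (l : R) : Prop :=
  forall z e, inH z -> 0 < e -> exists T, forall t, T < t -> 0 < t /\
    Cmod (phi t z - Ci * (l * sqrt t)%R)%C <= e * sqrt t.

(** Write t = tau + s with tau on a fine lattice. Then phi t z = phi tau (phi s z), and [phi s z] is
    hyperbolically close to z, by right continuity and because Julia's lemma keeps its height at
    least Im z. The contraction [phi tau] preserves this closeness, so phi t z differs from phi tau
    z by a small fraction of its modulus: continuity at 0 for one point is enough. *)
Lemma continuous_asymptotics (phi : R -> C -> C) :
  semigroupH phi -> non_ellipticH phi -> DW_infty phi -> sqrt_bounded_orbit phi ->
  exists l, 0 < l /\ sqrt_asymptotic phi l.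
Proof.
  intros Hs Hne HD Hb.
  destruct (lattice_asymptotics phi Hs Hne HD Hb) as (c & Hc & HL).
  set (l := sqrt (2 * c)).
  assert (Hl : 0 < l) by (apply sqrt_lt_R0; lra).
  assert (Hl2 : l ^ 2 = 2 * c) by (apply pow2_sqrt; lra).
  exists l. split; trivial. intros z e Hz He.
  assert (Hzp : 0 < Im z) by exact Hz.
  assert (A2 := proj1 (proj2 Hs)).
  (* The relative error k |w| with |w| <= 2 l sqrt t becomes (e/3) sqrt t. The other two thirds pay
     for the lattice asymptotics and for replacing sqrt tau by sqrt t. *)
  set (k := Rmin 1 (e / (6 * l))).
  assert (Hk : 0 < k) by (apply Rmin_pos; [lra|apply Rdiv_lt_0_compat; lra]).
  assert (Hk1 : k <= 1) by apply Rmin_l.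
  assert (Hk2 : k * (6 * l) <= e) by (apply (Rle_div_r k e (6 * l)); [lra|apply Rmin_r]).
  destruct (right_continuity phi z (k / 2 * Im z) Hs Hz) as (d & Hd & Hdz). nra.
  destruct (nfloor_ex (/ d)) as [m [_ Hm]]. left; apply Rinv_0_lt_compat; trivial.
  set (h := / INR (S m)).
  assert (Hm1 : 1 <= INR (S m)) by (change 1 with (INR 1); apply le_INR; lia).
  assert (Hh : 0 < h) by (apply Rinv_0_lt_compat; lra).
  assert (Hhd : h < d).
  { rewrite <- (Rinv_inv d). apply Rinv_lt_contravar; [|rewrite S_INR; lra].
    apply Rmult_lt_0_compat; [apply Rinv_0_lt_compat|]; lra. }
  assert (Hh1 : h <= 1) by (rewrite <- Rinv_1; apply Rinv_le_contravar; lra).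
  (* Division by [l] turns these into e/3, the share of the lattice error, and [l], the crude error
     behind |w| <= 2 l sqrt t. *)
  set (e2 := Rmin (l * e / 3) (l ^ 2)).
  assert (He2 : 0 < e2) by (apply Rmin_pos; nra).
  destruct (HL m z e2 Hz He2) as [N HN]. fold h in HN.
  (* The + 1 covers the rounding down to the lattice, as h <= 1; the 1 inside the maximum makes tau
     positive; the square gives l <= (e/3) sqrt t. *)
  set (T := Rmax (INR (max N 1) + 1) ((3 * l / e) ^ 2)).
  exists T. intros t Ht.
  assert (Ht1 : INR (max N 1) + 1 < t) by (eapply Rle_lt_trans; [apply Rmax_l|exact Ht]).
  assert (Ht2 : (3 * l / e) ^ 2 < t) by (eapply Rle_lt_trans; [apply Rmax_r|exact Ht]).
  assert (HNp := pos_INR (max N 1)). split. lra.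
  destruct (nfloor_ex (t / h)) as [n [Hn1 Hn2]]. { left; apply Rdiv_lt_0_compat; lra. }
  apply (proj2 (Rle_div_r _ _ _ Hh)) in Hn1. apply (proj1 (Rlt_div_l _ _ _ Hh)) in Hn2.
  assert (HnN : (max N 1 <= n)%nat).
  { apply INR_le. assert (INR n * h <= INR n * 1) by (apply Rmult_le_compat_l; [apply pos_INR|trivial]). lra. }
  specialize (HN n ltac:(lia)). cbv zeta in HN.
  set (tau := INR n * h) in *.
  assert (Htau : 0 < tau).
  { apply Rmult_lt_0_compat; trivial. apply lt_0_INR; lia. }
  set (w := phi tau z) in *.
  assert (Hw : inH w) by (apply A2; trivial; lra).
  assert (HwA : Cmod (w - Ci * (l * sqrt tau)%R)%C <= e2 / l * sqrt tau).
  { apply sqrt_of_square; trivial. rewrite Hl2, !RtoC_mult. exact HN. }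
  assert (He2a : e2 / l <= e / 3).
  { apply (Rle_div_l e2 (e / 3) l Hl). eapply Rle_trans. apply Rmin_l. right; field. }
  assert (He2b : e2 / l <= l).
  { apply (Rle_div_l e2 l l Hl). eapply Rle_trans. apply Rmin_r. right; ring. }
  assert (Hth : 0 <= t - tau < h) by (unfold tau in *; lra).
  set (s := t - tau) in *. assert (Hs0 : 0 <= s < d) by lra.
  set (a := phi s z). assert (Ha : inH a) by (apply A2; trivial; lra).
  assert (Hv : phi t z = phi tau a).
  { unfold a. rewrite <- (proj1 (proj2 (proj2 (proj2 Hs)))); trivial; try lra. f_equal. unfold s; ring. }
  rewrite Hv. set (v := phi tau a). assert (Hv' : inH v) by (apply A2; trivial; lra).
  assert (Hvw : Cmod (w - v)%C ^ 2 <= (k / 2) ^ 2 * (Im w * Im v)).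
  { assert (P := semigroup_pick phi tau Hs ltac:(lra) z a Hz Ha). fold w v in P.
    assert (J := semigroup_julia phi s z Hs HD ltac:(lra) Hz). fold a in J.
    assert (D := Hdz s Hs0). fold a in D. unfold inH in *.
    assert (D2 : Cmod (z - a)%C ^ 2 <= (k / 2) ^ 2 * (Im z * Im a)).
    { replace (Cmod (z - a)%C) with (Cmod (a - z)%C) by (rewrite <- Cmod_opp; f_equal; ring).
      apply Rle_trans with ((k / 2 * Im z) ^ 2). apply pow_incr. split; [apply Cmod_ge_0|trivial].
      rewrite Rpow_mult_distr. apply Rmult_le_compat_l. apply pow2_ge_0. nra. }
    assert (Q : 0 < Im z * Im a) by (apply Rmult_lt_0_compat; lra).
    apply (Rmult_le_reg_r (Im z * Im a)); trivial. eapply Rle_trans. exact P.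
    replace ((k / 2) ^ 2 * (Im w * Im v) * (Im z * Im a)) with ((k / 2) ^ 2 * (Im z * Im a) * (Im w * Im v)) by ring.
    apply Rmult_le_compat_r; trivial. nra. }
  destruct (close_points_comparable v w ((k / 2) ^ 2) ltac:(apply pow2_ge_0) Hv' Hw Hvw) as [_ Hvw2].
  assert (Hvw3 : Cmod (v - w)%C <= k * Cmod w).
  { replace (Cmod (v - w)%C) with (Cmod (w - v)%C) by (rewrite <- Cmod_opp; f_equal; ring).
    assert (T1 := im_le_Cmod w). unfold inH in Hw.
    apply Rle_trans with (k * Im w); [|nra].
    apply Rsqr_incr_0_var; [|nra]. rewrite !Rsqr_pow2. eapply Rle_trans. exact Hvw2.
    rewrite Rpow_mult_distr. apply Rmult_le_compat_r. apply pow2_ge_0.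
    assert (k ^ 2 <= 1) by (rewrite <- (pow1 2); apply pow_incr; lra).
    assert (K0 := pow2_ge_0 k). replace ((k / 2) ^ 2) with (k ^ 2 / 4) by field. nra. }
  assert (Hst0 := sqrt_pos tau).
  assert (Hst1 : sqrt tau <= sqrt t) by (apply sqrt_le_1_alt; lra).
  assert (Hst2 : sqrt t <= sqrt tau + 1).
  { apply Rsqr_incr_0_var; [|lra]. unfold Rsqr. rewrite sqrt_sqrt by lra.
    assert (U := sqrt_sqrt tau ltac:(lra)). unfold s in Hth. lra. }
  assert (Hwm : Cmod w <= 2 * l * sqrt t).
  { replace w with ((w - Ci * (l * sqrt tau)%R) + Ci * (l * sqrt tau)%R)%C by ring.
    eapply Rle_trans. apply Cmod_triangle. rewrite Cmod_mult, Cmod_Ci, Cmod_R, Rabs_pos_eq by nra.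
    nra. }
  assert (Hlt : 3 * l <= e * sqrt t).
  { assert (U : 3 * l / e <= sqrt t).
    { rewrite <- (sqrt_pow2 (3 * l / e)); [apply sqrt_le_1_alt; lra|]. apply Rle_div_r; lra. }
    apply (proj1 (Rle_div_l _ _ _ He)) in U. lra. }
  replace (v - Ci * (l * sqrt t)%R)%C with
    ((v - w) + ((w - Ci * (l * sqrt tau)%R) + Ci * (- (l * (sqrt t - sqrt tau)))%R))%C.
  2:{ rewrite RtoC_opp, !RtoC_mult, RtoC_minus. ring. }
  eapply Rle_trans. apply Cmod_triangle.
  assert (T2 := Cmod_triangle (w - Ci * (l * sqrt tau)%R) (Ci * (- (l * (sqrt t - sqrt tau)))%R)).
  rewrite (Cmod_mult Ci), Cmod_Ci, Cmod_R, Rabs_Ropp, Rabs_pos_eq in T2 by nra.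
  assert (B1 : Cmod (v - w)%C <= e / 3 * sqrt t).
  { eapply Rle_trans. exact Hvw3. apply Rle_trans with (k * (2 * l * sqrt t)). nra.
    replace (k * (2 * l * sqrt t)) with (k * (6 * l) / 3 * sqrt t) by field. apply Rmult_le_compat_r; lra. }
  assert (B2 : e2 / l * sqrt tau <= e / 3 * sqrt t).
  { apply Rmult_le_compat; trivial. left; apply Rdiv_lt_0_compat; trivial. }
  assert (B3 : l * (sqrt t - sqrt tau) <= l) by nra.
  lra.
Qed.

(** With p = |w + i| and q = |w - i| the quotient is (p + q) / (p - q), and p^2 - q^2 = 4 Im w
    removes the difference, which would be delicate for large w. *)
Lemma dH_Ci (w : C) : inH w ->
  dH Ci w = / 2 * ln ((Cmod (w + Ci)%C + Cmod (w - Ci)%C) ^ 2 / (4 * Im w)).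
Proof.
  intros Hw. unfold inH in Hw. unfold dH, rhoH. do 2 f_equal.
  replace (Cmod (Ci - w)%C) with (Cmod (w - Ci)%C) by (rewrite <- Cmod_opp; f_equal; ring).
  replace (Cmod (Ci - Cconj w)%C) with (Cmod (w + Ci)%C).
  2:{ rewrite <- Cmod_conj, <- Cmod_opp. f_equal. apply injective_projections; simpl; ring. }
  assert (E : Cmod (w + Ci)%C ^ 2 = Cmod (w - Ci)%C ^ 2 + 4 * Im w).
  { rewrite !Cmod2_alt. unfold Re, Im; simpl. ring. }
  assert (N1 := Cmod_ge_0 (w - Ci)%C). assert (N2 := Cmod_ge_0 (w + Ci)%C).
  set (p := Cmod (w + Ci)%C) in *. set (q := Cmod (w - Ci)%C) in *.
  assert (Hpq : q < p) by nra.
  assert (E2 : 4 * Im w = (p - q) * (p + q)) by nra. rewrite E2. field. lra.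
Qed.

(** * Hyperbolic distance to the orbit *)

Lemma sqrt_eventually (x : R) : forall t, x ^ 2 < t -> x <= sqrt t.
Proof.
  intros t Ht. eapply Rle_trans. apply Rle_abs. rewrite <- sqrt_Rsqr_abs, Rsqr_pow2.
  apply sqrt_le_1_alt. lra.
Qed.

Lemma sqrt_asymptotic_modulus (phi : R -> C -> C) (l : R) (z k : C) :
  sqrt_asymptotic phi l -> 0 < l -> inH z ->
  is_lim (fun t => Cmod (phi t z + k)%C / sqrt t) p_infty l.
Proof.
  intros H Hl Hz. apply is_lim_spec. intros eps. simpl. assert (He := cond_pos eps).
  destruct (H z (eps / 3) Hz ltac:(lra)) as [T HT].
  exists (Rmax T ((3 * Cmod k / eps) ^ 2)). intros t Ht.
  destruct (HT t) as [Ht0 HA]. { eapply Rle_lt_trans; [apply Rmax_l|exact Ht]. }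
  assert (Hs : 3 * Cmod k / eps <= sqrt t).
  { apply sqrt_eventually. eapply Rle_lt_trans; [apply Rmax_r|exact Ht]. }
  assert (Hst : 0 < sqrt t) by (apply sqrt_lt_R0; trivial).
  apply (proj1 (Rle_div_l _ _ _ He)) in Hs.
  set (v := phi t z) in *. set (s := sqrt t) in *.
  assert (Hc : Cmod (Ci * (l * s)%R)%C = l * s).
  { rewrite Cmod_mult, Cmod_Ci, Cmod_R, Rabs_pos_eq by nra. ring. }
  assert (B1 := Cmod_triangle (v - Ci * (l * s)%R) (Ci * (l * s)%R + k)).
  replace (v - Ci * (l * s)%R + (Ci * (l * s)%R + k))%C with (v + k)%C in B1 by ring.
  assert (B2 := Cmod_triangle (Ci * (l * s)%R) k).
  assert (B3 := Cmod_minus_le (v + k) (v - Ci * (l * s)%R + k)).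
  replace (v + k - (v - Ci * (l * s)%R + k))%C with (Ci * (l * s)%R)%C in B3 by ring.
  assert (B4 := Cmod_triangle (v - Ci * (l * s)%R) k).
  rewrite Hc in *.
  replace (Cmod (v + k)%C / s - l) with ((Cmod (v + k)%C - l * s) / s) by (field; lra).
  rewrite Rabs_div by lra. rewrite (Rabs_pos_eq s) by lra. apply Rlt_div_l; trivial.
  assert (0 < eps * s) by nra.
  apply Rabs_def1; lra.
Qed.

Lemma sqrt_asymptotic_im (phi : R -> C -> C) (l : R) (z : C) :
  sqrt_asymptotic phi l -> inH z -> is_lim (fun t => Im (phi t z) / sqrt t) p_infty l.
Proof.
  intros H Hz. apply is_lim_spec. intros eps. simpl. assert (He := cond_pos eps).
  destruct (H z (eps / 2) Hz ltac:(lra)) as [T HT].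
  exists T. intros t Ht. destruct (HT t Ht) as [Ht0 HA].
  assert (Hst : 0 < sqrt t) by (apply sqrt_lt_R0; trivial).
  assert (B := Rabs_im_le_Cmod (phi t z - Ci * (l * sqrt t)%R)%C).
  replace (Im (phi t z - Ci * (l * sqrt t)%R)%C) with (Im (phi t z) - l * sqrt t) in B
    by (unfold Im; simpl; ring).
  replace (Im (phi t z) / sqrt t - l) with ((Im (phi t z) - l * sqrt t) / sqrt t) by (field; lra).
  rewrite Rabs_div by lra. rewrite (Rabs_pos_eq (sqrt t)) by lra. apply Rlt_div_l; trivial.
  nra.
Qed.

Lemma is_lim_continuous_comp (g f : R -> R) (l : R) :
  continuous g l -> is_lim f p_infty l -> is_lim (fun t => g (f t)) p_infty (g l).
Proof. intros Hg Hf. exact (filterlim_comp _ _ _ f g _ _ _ Hf Hg). Qed.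

(** As (1/4) ln t = (1/2) ln (sqrt t), the correction is absorbed by rescaling; what remains depends
    continuously on three quantities that have limits. *)
Lemma devH_eq (phi : R -> C -> C) z t : inH (phi t z) -> 0 < t ->
  devH phi z t = / 2 * ln ((Cmod (phi t z + Ci)%C / sqrt t + Cmod (phi t z + - Ci)%C / sqrt t) ^ 2 * / 4
     * / (Im (phi t z) / sqrt t)).
Proof.
  intros Hv Ht. unfold devH. rewrite dH_Ci by trivial. unfold inH in Hv.
  change (phi t z - Ci)%C with (phi t z + - Ci)%C.
  assert (Hst : 0 < sqrt t) by (apply sqrt_lt_R0; trivial).
  set (p := Cmod (phi t z + Ci)%C). set (q := Cmod (phi t z + - Ci)%C).
  assert (Hp : 0 < p).
  { eapply Rlt_le_trans; [|apply im_le_Cmod]. unfold Im in *; simpl. lra. }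
  assert (Hq : 0 <= q) by apply Cmod_ge_0.
  assert (HX : 0 < (p + q) ^ 2 / (4 * Im (phi t z))) by (apply Rdiv_lt_0_compat; [apply pow_lt|]; lra).
  replace ((p / sqrt t + q / sqrt t) ^ 2 * / 4 * / (Im (phi t z) / sqrt t))
    with ((p + q) ^ 2 / (4 * Im (phi t z)) / sqrt t) by (field; lra).
  rewrite (ln_div ((p + q) ^ 2 / (4 * Im (phi t z))) (sqrt t) HX Hst).
  assert (E : ln t = 2 * ln (sqrt t)).
  { rewrite <- (sqrt_sqrt t) at 1 by lra. rewrite ln_mult by trivial. ring. }
  rewrite E. field.
Qed.

Lemma sqrt_asymptotic_devH (phi : R -> C -> C) (l : R) (z : C) : semigroupH phi ->
  sqrt_asymptotic phi l -> 0 < l -> inH z -> is_lim (devH phi z) p_infty (/ 2 * ln l).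
Proof.
  intros Hs H Hl Hz.
  apply (is_lim_ext_loc (fun t => / 2 * ln ((Cmod (phi t z + Ci)%C / sqrt t + Cmod (phi t z + - Ci)%C / sqrt t) ^ 2 * / 4
     * / (Im (phi t z) / sqrt t)))).
  { exists 0. intros t Ht. symmetry. apply devH_eq; trivial. apply Hs; trivial. lra. }
  assert (L1 := sqrt_asymptotic_modulus phi l z Ci H Hl Hz).
  assert (L2 := sqrt_asymptotic_modulus phi l z (- Ci)%C H Hl Hz).
  assert (L3 := sqrt_asymptotic_im phi l z H Hz).
  assert (Hinv : continuous Rinv l) by (apply (continuous_Rinv l); lra).
  assert (L4 := is_lim_continuous_comp Rinv _ l Hinv L3).
  assert (L5 := is_lim_plus' _ _ _ _ _ L1 L2).
  assert (Hsq : continuous (fun x => x ^ 2 * / 4) (l + l)).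
  { apply (ex_derive_continuous (K := R_AbsRing) (V := R_NormedModule)). auto_derive. trivial. }
  assert (L6 := is_lim_continuous_comp _ _ _ Hsq L5).
  assert (L7 := is_lim_mult _ _ p_infty (Finite ((l + l) ^ 2 * / 4)) (Finite (/ l)) L6 L4 I).
  cbv [Rbar_mult Rbar_mult'] in L7.
  (* Both shifted moduli and the height scale to [l], so the argument of the logarithm tends to
     (2l)^2 / (4l) = l. *)
  replace ((l + l) ^ 2 * / 4 * / l) with l in L7 by (field; lra).
  assert (Hln : continuous (fun x => / 2 * ln x) l).
  { apply (ex_derive_continuous (K := R_AbsRing) (V := R_NormedModule)). auto_derive. trivial. }
  exact (is_lim_continuous_comp _ _ _ Hln L7).
Qed.

(** The bound reads (p + q)^2 <= 4 exp (2M) Im w sqrt t with p = |w + i|. Since p dominates both |w|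
    and Im w, the left side is at least |w| Im w, and Im w cancels. *)
Lemma limsup_sqrt_bounded_orbit (phi : R -> C -> C) z : semigroupH phi -> inH z ->
  limsup_finite_above (devH phi z) -> sqrt_bounded_orbit phi.
Proof.
  intros Hs Hz (M & T & H).
  exists z, (4 * exp (2 * M)), (Rmax T 0). split; trivial. intros t Ht.
  assert (HtT : T < t) by (eapply Rle_lt_trans; [apply Rmax_l|exact Ht]).
  assert (Ht0 : 0 < t) by (eapply Rle_lt_trans; [apply Rmax_r|exact Ht]).
  specialize (H t HtT).
  assert (Hw : inH (phi t z)) by (apply Hs; trivial; lra).
  rewrite devH_eq in H by trivial. unfold inH in Hw.
  set (w := phi t z) in *.
  assert (Hst : 0 < sqrt t) by (apply sqrt_lt_R0; trivial). set (s := sqrt t) in *.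
  assert (Hp1 : Im w + 1 <= Cmod (w + Ci)%C).
  { eapply Rle_trans; [|apply im_le_Cmod]. unfold Im; simpl. lra. }
  assert (Hp2 : Cmod w <= Cmod (w + Ci)%C).
  { apply Cmod_le_sqr. rewrite !Cmod2_alt. unfold Re, Im in *; simpl. nra. }
  set (p := Cmod (w + Ci)%C) in *.
  assert (Hq : 0 <= Cmod (w + - Ci)%C) by apply Cmod_ge_0.
  set (q := Cmod (w + - Ci)%C) in *.
  set (X := (p / s + q / s) ^ 2 * / 4 * / (Im w / s)) in *.
  assert (E : X = (p + q) ^ 2 / (4 * Im w * s)) by (unfold X; field; lra).
  assert (Hd : 0 < 4 * Im w * s) by (apply Rmult_lt_0_compat; lra).
  assert (HX : 0 < X) by (rewrite E; apply Rdiv_lt_0_compat; trivial; apply pow_lt; lra).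
  assert (HXM : X <= exp (2 * M)).
  { rewrite <- (exp_ln X) by trivial.
    destruct (Rle_lt_or_eq_dec (ln X) (2 * M)) as [L|L]; [lra| |].
    left; apply exp_increasing; trivial. rewrite L; lra. }
  rewrite E in HXM. apply (proj1 (Rle_div_l _ _ _ Hd)) in HXM.
  assert (HEp := exp_pos (2 * M)). set (e := exp (2 * M)) in *.
  eapply Rle_trans. exact Hp2.
  apply (Rmult_le_reg_r (Im w)); trivial.
  apply Rle_trans with ((p + q) ^ 2); [nra|]. lra.
Qed.

Lemma lim_limsup_finite (f : R -> R) : has_real_lim f -> limsup_finite_above f.
Proof.
  intros [l Hl]. apply is_lim_spec in Hl. destruct (Hl (mkposreal 1 Rlt_0_1)) as [T HT].
  exists (l + 1), T. intros t Ht. specialize (HT t Ht). simpl in HT.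
  apply Rabs_lt_between in HT. lra.
Qed.

Lemma extremal_sqrt_bounded_orbit (phi : R -> C -> C) : extremal_rate phi -> sqrt_bounded_orbit phi.
Proof.
  intros (L & HL & H). assert (Hi : inH Ci) by apply Rlt_0_1.
  specialize (H Ci Hi). apply is_lim_spec in H. destruct (H (mkposreal 1 Rlt_0_1)) as [T HT].
  exists Ci, (L + 1), (Rmax T 0). split; trivial. intros t Ht.
  assert (HtT : T < t) by (eapply Rle_lt_trans; [apply Rmax_l|exact Ht]).
  assert (Ht0 : 0 < t) by (eapply Rle_lt_trans; [apply Rmax_r|exact Ht]).
  specialize (HT t HtT). simpl in HT. apply Rabs_lt_between in HT.
  apply (Rle_div_l _ _ _ (sqrt_lt_R0 t Ht0)). lra.
Qed.

Theorem theorem6p1 (phi : R -> C -> C) :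
  semigroupH phi -> non_ellipticH phi -> DW_infty phi ->
  parabolicH phi -> zero_hyp_step phi ->
  (* (a) <-> (b), "some" and "all" versions *)
  (extremal_rate phi <-> exists z, inH z /\ limsup_finite_above (devH phi z)) /\
  (extremal_rate phi <-> forall z, inH z -> limsup_finite_above (devH phi z)) /\
  (* (a) <-> (c), "some" and "all" versions *)
  (extremal_rate phi <-> exists z, inH z /\ has_real_lim (devH phi z)) /\
  (extremal_rate phi <-> forall z, inH z -> has_real_lim (devH phi z)) /\
  (* moreover *)
  (extremal_rate phi ->
     exists L : R, 0 < L /\
       is_lim (fun t => Cmod (phi t Ci) / sqrt t) p_infty L /\
       forall z, inH z -> is_lim (devH phi z) p_infty (/ 2 * ln L)).
Proof.
  intros Hs Hne HD _ _.
  assert (Hi : inH Ci) by apply Rlt_0_1.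
  (* Every condition, even at a single point, passes through one orbit of order sqrt t, and from
     there the conclusions return for all z with the same [L]; this settles the some/all variants
     together. *)
  assert (Key : sqrt_bounded_orbit phi -> exists L, 0 < L /\
    (forall z, inH z -> is_lim (fun t => Cmod (phi t z) / sqrt t) p_infty L) /\
    forall z, inH z -> is_lim (devH phi z) p_infty (/ 2 * ln L)).
  { intros Hb. destruct (continuous_asymptotics phi Hs Hne HD Hb) as (l & Hl & H).
    exists l. split; trivial. split; intros z Hz.
    - apply (is_lim_ext (fun t => Cmod (phi t z + 0)%C / sqrt t)).
      { intros t. rewrite Cplus_0_r. reflexivity. }
      apply sqrt_asymptotic_modulus; trivial.
    - apply sqrt_asymptotic_devH; trivial. }
  assert (Hba : forall z, inH z -> limsup_finite_above (devH phi z) -> extremal_rate phi).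
  { intros z Hz Hb. destruct (Key (limsup_sqrt_bounded_orbit phi z Hs Hz Hb)) as (L & HL & H & _).
    exists L; auto. }
  assert (Hac : extremal_rate phi -> forall z, inH z -> has_real_lim (devH phi z)).
  { intros He z Hz. destruct (Key (extremal_sqrt_bounded_orbit phi He)) as (L & HL & _ & H).
    exists (/ 2 * ln L). auto. }
  assert (Hab : extremal_rate phi -> forall z, inH z -> limsup_finite_above (devH phi z)).
  { intros He z Hz. apply lim_limsup_finite, Hac; trivial. }
  repeat split.
  - intros He. exists Ci. auto.
  - intros (z & Hz & Hb). eauto.
  - exact Hab.
  - intros Hb. eauto.
  - intros He. exists Ci. auto.
  - intros (z & Hz & Hb). apply (Hba z Hz), lim_limsup_finite; trivial.
  - exact Hac.
  - intros Hb. apply (Hba Ci Hi), lim_limsup_finite; auto.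
  - intros He. destruct (Key (extremal_sqrt_bounded_orbit phi He)) as (L & HL & H1 & H2).
    exists L. auto.
Qed.
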